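(* Let $f,g\in\mathcal{O}_K[x_1,\ldots,x_n]\setminus\pi\mathcal{O}_K[x_1,\ldots,x_n]$ ($n\ge 2$) be non-constant co-prime polynomials with $f(\boldsymbol 0)=g(\boldsymbol 0)=0$ and $\Gamma(f)\ne\Gamma(g)$, such that $\frac fg$ is non-degenerate over $\mathbb{F}_q$ with respect to $\Gamma(\frac fg)$, and let $\chi$ be a character of $\mathcal{O}_K^\times$. Let $(t_0,\ldots,t_0)$ be the unique intersection point of the diagonal $\{(t,\ldots,t):t\in\mathbb{R}\}$ with the boundary of $\Gamma(\frac fg)$. Then for every pole $s$ of $Z(s,\chi,\frac fg)$ with $\operatorname{Re}(s)<0$ one has $\operatorname{Re}(s)\le-1/t_0$ if $\chi\neq\chi_{triv}$; and $\operatorname{Re}(s)=-1$ or $\operatorname{Re}(s)\le-1/t_0$ if $\chi=\chi_{triv}$.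
   Context: $K$ is a non-Archimedean local field of arbitrary characteristic, $\mathcal{O}_K$ its ring of integers, $\pi$ a fixed uniformizer, $\mathbb{F}_q$ the residue field, $\nu$ the valuation, $|z|_K=q^{-\nu(z)}$, $ac(z)=z\pi^{-\nu(z)}$ for $z\ne0$. $|d\boldsymbol x|_K$ is the Haar measure on $K^n$ with $\mathcal{O}_K^n$ of measure $1$. A bar denotes reduction modulo $\pi\mathcal{O}_K$. A character $\chi$ of $\mathcal{O}_K^\times$ is a continuous homomorphism to the complex unit circle, with $\chi(0)=0$ formally; $\chi_{triv}$ is the trivial character. Newton polyhedra. $\mathbb{R}_+=\{x\in\mathbb{R}:x\ge0\}$. For a non-constant polynomial $h=\sum c_{\boldsymbol m}\boldsymbol x^{\boldsymbol m}$ over $\mathcal{O}_K$ with $h(\boldsymbol 0)=0$, $\Gamma(h)$ is the convex hull of $\bigcup_{c_{\boldsymbol m}\ne0}(\boldsymbol m+\mathbb{R}_+^n)$. For $\boldsymbol k\in\mathbb{R}_+^n$: $d(\boldsymbol k,\Gamma)=\min_{\boldsymbol x\in\Gamma}\langle\boldsymbol k,\boldsymbol x\rangle$, $F(\boldsymbol k,\Gamma)=\{\boldsymbol x\in\Gamma:\langle\boldsymbol k,\boldsymbol x\rangle=d(\boldsymbol k,\Gamma)\}$, $h_{\boldsymbol k}(\boldsymbol x)=\sum_{\boldsymbol m\in F(\boldsymbol k,\Gamma(h))}c_{\boldsymbol m}\boldsymbol x^{\boldsymbol m}$. Put $\Gamma(\frac fg)=\Gamma(fg)$. Non-degeneracy.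 $\frac fg$ is non-degenerate over $\mathbb{F}_q$ with respect to $\Gamma(\frac fg)$ if, with $(h_1,h_2)=(f,g)$, for every $\boldsymbol k\in\mathbb{R}_+^n$, every non-empty $I\subseteq\{1,2\}$ and every $\overline{\boldsymbol z}\in(\mathbb{F}_q^\times)^n$ such that $\overline h_{i,\boldsymbol k}(\overline{\boldsymbol z})=0\Leftrightarrow i\in I$, the matrix $[\partial\overline h_{i,\boldsymbol k}/\partial x_j(\overline{\boldsymbol z})]_{i\in I,1\le j\le n}$ has rank $\mathrm{Card}(I)$. Zeta function. $Z(s,\chi,\frac fg):=Z(s,-s,\chi,\chi^{-1},f,g)$, where $Z(s_1,s_2,\chi_1,\chi_2,f,g)$ is the meromorphic continuation to $\mathbb{C}^2$ (as a rational function of $q^{-s_1},q^{-s_2}$) of $\int_{\mathcal{O}_K^n}\chi_1(ac(f(\boldsymbol x)))\chi_2(ac(g(\boldsymbol x)))|f(\boldsymbol x)|_K^{s_1}|g(\boldsymbol x)|_K^{s_2}|d\boldsymbol x|_K$, $\operatorname{Re}(s_i)>0$. *)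

(* Defs.v *)
From HB Require Import structures.
From mathcomp Require Import all_boot all_order all_algebra.
From mathcomp Require Import all_classical all_reals all_analysis.
From mathcomp Require Import complex.
(* The notations of multinomials clash with those of mathcomp-analysis. *)
From mathcomp Require Import -(notations) mpoly.
Import numFieldNormedType.Exports.
Import Order.TTheory GRing.Theory Num.Theory.

Set Implicit Arguments.
Unset Strict Implicit.
Unset Printing Implicit Defensive.

Local Open Scope classical_set_scope.
Local Open Scope complex_scope.
Local Open Scope ring_scope.

(* A normalized discrete valuation; [nu 0] is a junk value, the convention
   nu 0 = +oo is built into [vge] below. *)
HB.mixin Record isDiscretelyValued K of GRing.Field K := {
  nu : K -> int;
  nuM : forall x y : K, x != 0 -> y != 0 -> nu (x * y) = nu x + nu y;
  nuD : forall x y : K, x != 0 -> y != 0 -> x + y != 0 ->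
    Num.min (nu x) (nu y) <= nu (x + y);
  nu_normalized : exists2 x : K, x != 0 & nu x = 1
}.

#[short(type="valuedFieldType")]
HB.structure Definition ValuedField :=
  {K of GRing.Field K & isDiscretelyValued K}.

Definition vge (K : valuedFieldType) (m : int) (x : K) : bool :=
  (x == 0) || (m <= nu x).

Section ValuationRing.
Variable K : valuedFieldType.
Implicit Types x y : K.

Lemma nu1 : nu (1 : K) = 0.
Proof.
apply: (@addrI _ (nu (1 : K))).
by rewrite addr0 -nuM ?oner_neq0 // mulr1.
Qed.

Lemma nuN x : nu (- x) = nu x.
Proof.
have [->|x0] := eqVneq x 0; first by rewrite oppr0.
have n1 : (-1 : K) != 0 by rewrite oppr_eq0 oner_neq0.
have e : nu (-1 : K) + nu (-1 : K) = 0 by rewrite -nuM // mulrNN mulr1 nu1.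
have e0 : nu (-1 : K) = 0.
  by move/eqP: e; rewrite -mulr2n mulrn_eq0 => /eqP.
by rewrite -mulN1r nuM // e0 add0r.
Qed.

Lemma nuV x : x != 0 -> nu x^-1 = - nu x.
Proof.
move=> x0; apply: (@addrI _ (nu x)).
by rewrite -nuM ?invr_neq0 // divff // nu1 subrr.
Qed.

Definition integers : {pred K} := fun x => vge 0 x.

Lemma integers_subring : subring_closed integers.
Proof.
split=> [|x y|x y]; rewrite !unfold_in /vge.
- by rewrite nu1 lexx orbT.
- have [->|x0] := eqVneq x 0; first by rewrite sub0r oppr_eq0 nuN.
  have [->|y0] := eqVneq y 0; first by rewrite subr0 (negPf x0).
  have Ny0 : - y != 0 by rewrite oppr_eq0.
  rewrite !orFb => hx hy; have [//|xy0] := eqVneq (x - y) 0.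
  by rewrite orFb (le_trans _ (nuD _ _ x0 Ny0 xy0)) // le_min hx nuN hy.
- have [->|x0] := eqVneq x 0; first by rewrite mul0r eqxx.
  have [->|y0] := eqVneq y 0; first by rewrite mulr0 eqxx.
  rewrite !orFb => hx hy.
  by rewrite mulf_eq0 (negPf x0) (negPf y0) nuM // addr_ge0.
Qed.

HB.instance Definition _ :=
  GRing.isSubringClosed.Build K integers integers_subring.

Record valuation_ring := ValuationRing {
  vring_val :> K;
  vring_valP : vring_val \in integers }.

HB.instance Definition _ := [isSub for vring_val].
HB.instance Definition _ := [Choice of valuation_ring by <:].
HB.instance Definition _ :=
  [SubChoice_isSubComNzRing of valuation_ring by <:].

Implicit Types a b : valuation_ring.

Definition vring_unit : {pred valuation_ring} :=
  fun a => (val a != 0) && ((val a)^-1 \in integers).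

Definition vring_inv a : valuation_ring :=
  if vring_unit a then insubd a (val a)^-1 else a.

Lemma vring_mulVx : {in vring_unit, left_inverse 1 vring_inv *%R}.
Proof.
move=> a ua; rewrite /vring_inv [vring_unit a]ua.
case/andP: ua => a0 ia; apply: val_inj.
by rewrite rmorphM rmorph1 /= val_insubd ia mulVf.
Qed.

Lemma vring_unitPl a b : b * a = 1 -> vring_unit a.
Proof.
move=> /(congr1 val); rewrite rmorphM rmorph1 /= => e.
have a0 : val a != 0.
  by apply: contra_eq_neq e => ->; rewrite mulr0 eq_sym oner_neq0.
apply/andP; split=> //.
suff -> : (val a)^-1 = val b by exact: valP.
by apply: (mulIf a0); rewrite e mulVf.
Qed.

Lemma vring_inv_out : {in [predC vring_unit], vring_inv =1 id}.
Proof. by move=> a /negPf na; rewrite /vring_inv [vring_unit a]na. Qed.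

HB.instance Definition _ := GRing.ComNzRing_hasMulInverse.Build valuation_ring
  vring_mulVx vring_unitPl vring_inv_out.

Lemma vring_integral (a b : valuation_ring) :
  a * b = 0 -> (a == 0) || (b == 0).
Proof.
move=> /(congr1 val); rewrite rmorphM rmorph0 => /eqP.
by rewrite mulf_eq0 => /orP[] /eqP h; apply/orP; [left|right];
  apply/eqP/val_inj; rewrite h rmorph0.
Qed.

HB.instance Definition _ :=
  GRing.ComUnitRing_isIntegral.Build valuation_ring vring_integral.

End ValuationRing.

(* The residue field is carried as a finite field together with a surjective
   morphism whose kernel is the maximal ideal. *)
HB.mixin Record isLocalField K of ValuedField K := {
  nu_complete : forall u : nat -> K,
    (forall m : int, exists N : nat, forall i j : nat,
       (N <= i)%N -> (N <= j)%N -> vge m (u i - u j)) ->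
    exists l : K, forall m : int, exists N : nat, forall i : nat,
       (N <= i)%N -> vge m (u i - l);
  residue_field : finFieldType;
  residue : {rmorphism valuation_ring K -> residue_field};
  residue_surj : forall y : residue_field,
    exists x : valuation_ring K, residue x = y;
  residue_ker : forall x : valuation_ring K,
    residue x = 0 <-> vge 1 (val x)
}.

#[short(type="localFieldType")]
HB.structure Definition LocalField :=
  {K of ValuedField K & isLocalField K}.

Definition qcard (K : localFieldType) : nat := #|@residue_field K|.

Definition uniformizer (K : valuedFieldType) (pi : valuation_ring K) : Prop :=
  val pi != 0 /\ nu (val pi) = 1.

(* For z = 0 this is 0; otherwise z * pi ^ (- nu z) is a unit, so that the
   default value of [insubd] is never used. *)
Definition ac (K : valuedFieldType) (pi : valuation_ring K) (z : K) :
    valuation_ring K :=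
  insubd 0 (z * val pi ^ (- nu z)).

Section Complex.
Variable R : realType.
Implicit Types s : R[i].

Definition cexp s : R[i] :=
  (expR (complex.Re s) * cos (complex.Im s)) +i*
  (expR (complex.Re s) * sin (complex.Im s)).

(* r ^ s for r >= 0, with 0 ^ s = 0 *)
Definition cpow (r : R) s : R[i] :=
  if r == 0 then 0 else cexp ((ln r)%:C * s).

Definition cintegral d (T : measurableType d) (mu : {measure set T -> \bar R})
    (D : set T) (h : T -> R[i]) : R[i] :=
  (\int[mu]_(x in D) complex.Re (h x)) +i*
  (\int[mu]_(x in D) complex.Im (h x)).

Definition is_pole (F : R[i] -> R[i]) s : Prop :=
  (complex.Re `|F z|) @[z --> (s : R[i]^o)^'] --> +oo.

End Complex.

Definition affine_space (K : localFieldType) (n : nat) : Type := 'rV[K]_n.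

HB.instance Definition _ (K : localFieldType) (n : nat) :=
  Choice.on (affine_space K n).
HB.instance Definition _ (K : localFieldType) (n : nat) :=
  isPointed.Build (affine_space K n) (0 : 'rV[K]_n).

Section Haar.
Variables (R : realType) (K : localFieldType) (n : nat).

Definition Kn_open : set (set (affine_space K n)) :=
  [set U | forall x : 'rV[K]_n, U x -> exists m : int,
     [set y : 'rV[K]_n | forall i, vge m (y 0 i - x 0 i)] `<=` U].

(* K^n with its Borel sigma-algebra *)
Definition Kn := g_sigma_algebraType Kn_open.

Definition On : set Kn := [set x : 'rV[K]_n | forall i, vge 0 (x 0 i)].

Definition is_haar (mu : {measure set Kn -> \bar R}) : Prop :=
  (forall (a : 'rV[K]_n) (A : set Kn), measurable A ->
     mu [set a + x | x in (A : set 'rV[K]_n)] = mu A) /\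
  mu On = 1%E.

End Haar.

Section Characters.
Variables (R : realType) (K : localFieldType).
Implicit Types chi : valuation_ring K -> R[i].

(* A character of the unit group, extended by 0 to the non-units. *)
Definition is_character chi : Prop :=
  [/\ forall u v, u \is a GRing.unit -> v \is a GRing.unit ->
        chi (u * v) = chi u * chi v,
      forall u, u \is a GRing.unit -> `|chi u| = 1,
      forall u (e : R), u \is a GRing.unit -> 0 < e ->
        exists m : int, forall v, v \is a GRing.unit ->
          vge m (val v - val u) -> `|chi v - chi u| < e%:C &
      forall z, z \isn't a GRing.unit -> chi z = 0].

Definition chi_triv : valuation_ring K -> R[i] :=
  fun z => if z \is a GRing.unit then 1 else 0.

End Characters.

Arguments chi_triv R K _ : clear implicits.

Section NewtonPolyhedra.
Variables (R : realType) (n : nat).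

Definition mnm_point (m : multinom n) : 'rV[R]_n := \row_i (m i)%:R.

Definition newton (A : nzRingType) (h : mpoly n A) : set 'rV[R]_n :=
  smallest (@convex_set R 'rV[R]_n)
    [set x | exists2 m, m \in msupp h & forall i, mnm_point m 0 i <= x 0 i].

Definition dotv (k x : 'rV[R]_n) : R := \sum_i k 0 i * x 0 i.

(* The infimum is attained on Newton polyhedra, for k with entries >= 0. *)
Definition dmin (k : 'rV[R]_n) (G : set 'rV[R]_n) : R :=
  inf [set dotv k x | x in G].

Definition face (k : 'rV[R]_n) (G : set 'rV[R]_n) : set 'rV[R]_n :=
  [set x | G x /\ dotv k x = dmin k G].

Definition face_poly (A : nzRingType) (k : 'rV[R]_n) (h : mpoly n A) :
    mpoly n A :=
  \sum_(m <- msupp h | `[< face k (newton h) (mnm_point m) >])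
     mcoeff m h *: mpolyX A m.

Definition boundary (G : set 'rV[R]_n) : set 'rV[R]_n :=
  closure G `\` interior G.

Definition diag_line : set 'rV[R]_n := [set const_mx t | t in [set: R]].

Section NonDegeneracy.
Variable K : localFieldType.

Definition newton_nondegenerate (f g : mpoly n (valuation_ring K)) : Prop :=
  let hbar k (i : 'I_2) : mpoly n (@residue_field K) :=
    map_mpoly residue (face_poly k (if i == 0 then f else g)) in
  forall (k : 'rV[R]_n) (I : {set 'I_2}) (z : 'I_n -> @residue_field K),
    (forall j, 0 <= k 0 j) -> I != finset.set0 -> (forall j, z j != 0) ->
    (forall i, meval z (hbar k i) = 0 <-> i \in I) ->
    \rank (\matrix_(i < #|I|, j < n)
             meval z (mderiv j (hbar k (enum_val i)))) = #|I|.

End NonDegeneracy.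
End NewtonPolyhedra.

Arguments newton R {n A} h _.
Arguments diag_line R n _ : clear implicits.

Definition mcoprime (n : nat) (A : idomainType) (f g : mpoly n A) : Prop :=
  forall d a b : mpoly n A, f = d * a -> g = d * b -> d \is a GRing.unit.

Section Zeta.
Variables (R : realType) (K : localFieldType) (n : nat).
Variables (pi : valuation_ring K) (mu : {measure set Kn K n -> \bar R}).
Implicit Types (f g : mpoly n (valuation_ring K)) (s : R[i]).
Implicit Types chi : valuation_ring K -> R[i].

Definition evalK f (x : 'rV[K]_n) : K := meval (x 0) (map_mpoly val f).

Definition absK (z : K) : R :=
  if z == 0 then 0 else (qcard K)%:R ^ (- nu z).

Definition zeta_integral chi1 chi2 f g s1 s2 : R[i] :=
  cintegral mu (@On K n) (fun x =>
    chi1 (ac pi (evalK f x)) * chi2 (ac pi (evalK g x)) *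
    cpow (absK (evalK f x)) s1 * cpow (absK (evalK g x)) s2).

(* value of a polynomial in two variables at (q ^ - s1, q ^ - s2) *)
Definition eval_q (P : mpoly 2 R[i]) s1 s2 : R[i] :=
  meval (fun i : 'I_2 => cpow (qcard K)%:R (- (if i == 0 then s1 else s2))) P.

(* P / Q is the meromorphic continuation of the integral. *)
Definition zeta_continuation chi1 chi2 f g (P Q : mpoly 2 R[i]) : Prop :=
  Q != 0 /\
  forall s1 s2, 0 < complex.Re s1 -> 0 < complex.Re s2 ->
    eval_q Q s1 s2 * zeta_integral chi1 chi2 f g s1 s2 = eval_q P s1 s2.

(* Z is the restriction to the line (s, - s) of the continuation P / Q, which
   must not have this line in its polar locus. The values of Z at the zeros of
   s |-> Q(q ^ - s, q ^ s), which are isolated, are irrelevant. *)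
Definition is_zeta chi f g (Z : R[i] -> R[i]) : Prop :=
  exists P Q : mpoly 2 R[i],
    [/\ zeta_continuation chi (fun z => (chi z)^-1) f g P Q,
        exists s, eval_q Q s (- s) != 0 &
        forall s, eval_q Q s (- s) != 0 ->
          Z s = eval_q P s (- s) / eval_q Q s (- s)].

End Zeta.

(* Main.v *)
Require Import Defs.
From HB Require Import structures.
From mathcomp Require Import all_boot all_order all_algebra.
From mathcomp Require Import all_classical all_reals all_analysis.
From mathcomp Require Import measurable_realfun complex ring lra zify.
From mathcomp Require Import -(notations) mpoly.
Import numFieldNormedType.Exports.
Import Order.TTheory GRing.Theory Num.Theory.

(** Why the theorem is true.  Put X = q^-s1 and Y = q^-s2.  For fixed Y with
|Y| < 1, grouping the points of O^n by the order j of f turns the integral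
into a power series in X, sum_j A_j X^j, where A_j is the integral of
chi(ac f) chi^-1(ac g) |g|^s2 over the shell ord f = j
([shell_expansion]).  The poles are controlled by the decay of the A_j after
one correction: with kappa = 1/q when chi is trivial and kappa = 0 otherwise,
A_j - kappa A_(j-1) is O(r^j) for every r > q^(-1/t0)
([shell_integral_decay]).  In other words (1 - kappa X) sum_j A_j X^j
converges for |X| < q^(1/t0), that is, for Re(s1) > -1/t0.

The decay is a local computation.  The points x with ord x_l = k_l for all l
and prescribed leading digits form a class, on which x = pi^k u with u a unit
vector fixed modulo pi; there f(x) = pi^a F(u) and g(x) = pi^b G(u), where
a = d(k, Gamma(f)), b = d(k, Gamma(g)), and F and G reduce to the face
polynomials of f and g.  If F(u) is a unit then ord f = a on the whole class.
If F(u), or both F(u) and G(u), vanish modulo pi, then non-degeneracy supplies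
directions along which F, or (F, G), is an isometry modulo powers of pi, hence
takes each value equally often ([equidistribution]), and the sum of
chi(ac F) over a shell is 0 if chi is not trivial and is divided by q when the
shell shrinks by one step if chi is trivial ([sum_dshell]).  So a class
contributes to A_j - kappa A_(j-1) only if j <= a + c + 1 for a constant c
depending on the conductor of chi ([class_cancellation]).  Finally
a <= t0 (k_1 + ... + k_n), because (t0, ..., t0) lies in the closure of
Gamma(fg), so only classes with k_1 + ... + k_n >= (j - c - 1) / t0 remain,
and their total measure is exponentially small ([grid_mean_shell_term]).
The sum over k is compared with a product of geometric series, one for each
coordinate.

All these sums are taken over the finite set of classes of O^n modulo pi^M;
uniform continuity of the integrands turns them into integrals
([Rintegral_grid_mean]).

The given continuation P / Q satisfies Q sum_j A_j X^j = P for small X, hence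
coefficientwise, so |(1 - kappa X) P| <= |Q| G / (1 - r |X|) holds on the
larger disc ([continuation_bound]).  On the line s2 = -s1 with
-1/t0 < Re(s1) < 0 this bounds |1 - kappa X| |Z|, and Z cannot tend to
infinity at a point where |kappa X| differs from 1 ([no_pole]).  For kappa = 1/q
the excluded case is Re(s1) = -1. *)

Set Implicit Arguments.
Unset Strict Implicit.
Unset Printing Implicit Defensive.

Local Open Scope classical_set_scope.
Local Open Scope complex_scope.
Local Open Scope ring_scope.

(** * Divisibility by powers of the uniformizer *)

Section Valuation.
Variables (K : localFieldType) (pi : valuation_ring K).
Hypothesis hpi : uniformizer pi.
Local Notation O := (valuation_ring K).
Implicit Types (x y z u : O) (e m N : nat).

(** Divisibility by the e-th power of a uniformizer, stated through the
valuation so that it does not depend on the choice of the uniformizer. *)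
Definition dv e x : bool := vge e%:Z (val x).

(** At 0 the value is junk; statements about [ord] exclude 0 or go through
[dv]. *)
Definition ord x : nat := `|nu (val x)|%N.

Lemma val_eq0 x : (val x == 0) = (x == 0).
Proof. by rewrite -(inj_eq val_inj) rmorph0. Qed.

Lemma nu_ord x : x != 0 -> nu (val x) = (ord x)%:Z.
Proof.
move=> x0; have := valP x; rewrite [_ \in _]/(vge _ _) /vge val_eq0 (negPf x0) /=.
by move=> h; rewrite /ord gez0_abs.
Qed.

Lemma dvE e x : dv e x = (x == 0) || (e <= ord x)%N.
Proof.
rewrite /dv /vge val_eq0; have [//|x0] := eqVneq x 0.
by rewrite nu_ord // lez_nat.
Qed.

Lemma dv_0 e : dv e 0. Proof. by rewrite dvE eqxx. Qed.
Lemma dv0 x : dv 0 x. Proof. by rewrite dvE leq0n orbT. Qed.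

Lemma dv_leq e m x : (e <= m)%N -> dv m x -> dv e x.
Proof. by rewrite !dvE => em /orP[->//|h]; rewrite (leq_trans em h) orbT. Qed.

Lemma dvN e x : dv e (- x) = dv e x.
Proof. by rewrite /dv /vge rmorphN /= oppr_eq0 nuN. Qed.

Lemma dvD e x y : dv e x -> dv e y -> dv e (x + y).
Proof.
rewrite /dv /vge rmorphD /=.
have [->|x0] := eqVneq (val x) 0; first by rewrite add0r.
have [->|y0] := eqVneq (val y) 0; first by rewrite addr0 (negPf x0).
rewrite !orFb => hx hy; have [//|xy0] := eqVneq (val x + val y) 0.
by rewrite orFb (le_trans _ (nuD _ _ x0 y0 xy0)) // le_min hx hy.
Qed.

Lemma dvB e x y : dv e x -> dv e y -> dv e (x - y).
Proof. by move=> hx hy; apply: dvD => //; rewrite dvN. Qed.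

Lemma dv_sym e x y : dv e (x - y) = dv e (y - x).
Proof. by rewrite -dvN opprB. Qed.

Lemma dv_trans e y x z : dv e (x - y) -> dv e (y - z) -> dv e (x - z).
Proof. by move=> h1 h2; rewrite -(subrK y x) -addrA dvD. Qed.

Lemma dv_eqr e x y : dv e (x - y) -> dv e x = dv e y.
Proof.
move=> h; apply/idP/idP => h1; last by rewrite -(subrK y x) dvD.
by rewrite -(subKr x y) dvB.
Qed.

Lemma dv_sum (I : Type) (r : seq I) (P : pred I) (F : I -> O) e :
  (forall i, P i -> dv e (F i)) -> dv e (\sum_(i <- r | P i) F i).
Proof.
by move=> h; apply: (big_ind (fun x => is_true (dv e x))) => //; [exact: dv_0|exact: dvD].
Qed.

Lemma ordM x y : x != 0 -> y != 0 -> ord (x * y) = (ord x + ord y)%N.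
Proof.
move=> x0 y0; apply/eqP; rewrite -eqz_nat PoszD -!nu_ord ?mulf_neq0 //.
by rewrite rmorphM nuM ?val_eq0.
Qed.

Lemma dvM e m x y : dv e x -> dv m y -> dv (e + m) (x * y).
Proof.
rewrite !dvE mulf_eq0; have [//|x0] := eqVneq x 0.
have [//|y0] := eqVneq y 0 => /=; by rewrite ordM //; apply: leq_add.
Qed.

Lemma dvMl e x y : dv e y -> dv e (x * y).
Proof. by move=> h; apply: (@dvM 0 e) => //; exact: dv0. Qed.

Lemma dvMr e x y : dv e x -> dv e (x * y).
Proof. by rewrite mulrC; apply: dvMl. Qed.

Lemma pi_neq0 : pi != 0.
Proof. by case: hpi => h _; rewrite -val_eq0. Qed.

Lemma ord_pi : ord pi = 1%N.
Proof. by case: hpi => _ h; rewrite /ord h. Qed.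

Lemma piX_neq0 e : pi ^+ e != 0. Proof. by rewrite expf_neq0 // pi_neq0. Qed.

Lemma ord_one : ord 1 = 0%N. Proof. by rewrite /ord rmorph1 nu1. Qed.

Lemma ord_piX e : ord (pi ^+ e) = e.
Proof.
elim: e => [|e IH]; first by rewrite expr0 ord_one.
by rewrite exprS ordM ?piX_neq0 ?pi_neq0 // ord_pi IH.
Qed.

Lemma dv_piXM e m x : dv (e + m) (pi ^+ e * x) = dv m x.
Proof.
rewrite !dvE mulf_eq0 (negPf (piX_neq0 _)) /=.
have [//|x0 /=] := eqVneq x 0.
by rewrite ordM ?piX_neq0 // ord_piX leq_add2l.
Qed.

Lemma dv_piM e x : dv e.+1 (pi * x) = dv e x.
Proof. by rewrite -[X in X * _]expr1 -add1n dv_piXM. Qed.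

Lemma dv_piX e x : dv e (pi ^+ e * x).
Proof. by rewrite -{1}[e]addn0 dv_piXM dv0. Qed.

Lemma unitE x : (x \is a GRing.unit) = ~~ dv 1 x.
Proof.
rewrite -[_ \is a _]/((val x != 0) && ((val x)^-1 \in @integers K)) dvE negb_or.
rewrite val_eq0; have [//|x0 /=] := eqVneq x 0.
rewrite [_ \in _]/(vge _ _) /vge invr_eq0 val_eq0 (negPf x0) /= nuV ?val_eq0 //.
by rewrite nu_ord //; lia.
Qed.

Lemma residue_eq0 x : (residue x == 0) = dv 1 x.
Proof. by apply/eqP/idP => /residue_ker. Qed.

Lemma dv1B x y : dv 1 (x - y) = (residue x == residue y).
Proof. by rewrite -residue_eq0 rmorphB subr_eq0. Qed.

Lemma residue_pi : residue pi = 0.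
Proof. by apply/eqP; rewrite residue_eq0 dvE ord_pi orbT. Qed.

Lemma unit_residue x : (x \is a GRing.unit) = (residue x != 0).
Proof. by rewrite unitE residue_eq0. Qed.

Lemma ord_unit u : u \is a GRing.unit -> ord u = 0%N.
Proof.
rewrite unitE dvE negb_or -leqNgt leqn0 => /andP[_ /eqP//].
Qed.

Lemma unit_neq0 u : u \is a GRing.unit -> u != 0.
Proof. by apply: contraTneq => ->; rewrite unitr0. Qed.

Lemma ord_piXu e u : u \is a GRing.unit -> ord (pi ^+ e * u) = e.
Proof.
by move=> hu; rewrite ordM ?piX_neq0 ?unit_neq0 // ord_piX ord_unit // addn0.
Qed.

Lemma ac_piXu e u : u \is a GRing.unit -> ac pi (val (pi ^+ e * u)) = u.
Proof.
move=> hu; rewrite /ac; apply: val_inj; rewrite val_insubd.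
have h0 : pi ^+ e * u != 0 by rewrite mulf_neq0 ?piX_neq0 ?unit_neq0.
have -> : nu (val (pi ^+ e * u)) = e by rewrite nu_ord // ord_piXu.
rewrite rmorphM rmorphXn /= -exprnN mulrAC divff ?mul1r; last first.
  by rewrite expf_neq0 // val_eq0 pi_neq0.
by have -> : val u \in @integers K by exact: valP.
Qed.

Lemma vdecomp x : x != 0 ->
  ac pi (val x) \is a GRing.unit /\ x = pi ^+ ord x * ac pi (val x).
Proof.
move=> x0; have hv : val pi != 0 by rewrite val_eq0 pi_neq0.
have e1 : nu (val x * val pi ^- ord x) = 0.
  rewrite nuM ?val_eq0 ?invr_neq0 ?expf_neq0 // -rmorphXn nuV ?val_eq0 ?piX_neq0 //.
  by rewrite !nu_ord ?piX_neq0 // ord_piX subrr.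
have e2 : val x * val pi ^- ord x \in @integers K.
  by rewrite [_ \in _]/(vge _ _) /vge e1 lexx orbT.
have e3 : val (ac pi (val x)) = val x * val pi ^- ord x.
  by rewrite /ac val_insubd nu_ord // -exprnN e2.
split; last first.
  by apply: val_inj; rewrite rmorphM rmorphXn /= e3 mulrC divfK // expf_neq0.
have h0 : ac pi (val x) != 0.
  by rewrite -val_eq0 e3 mulf_neq0 ?val_eq0 ?invr_neq0 ?expf_neq0.
by rewrite unitE dvE (negPf h0) /ord e3 e1.
Qed.

Lemma dvP e x : reflect (exists y, x = pi ^+ e * y) (dv e x).
Proof.
apply: (iffP idP) => [|[y ->]]; last exact: dv_piX.
rewrite dvE; have [->|x0 /= h] := eqVneq x 0; first by exists 0; rewrite mulr0.
have [_ h1] := vdecomp x0; exists (pi ^+ (ord x - e) * ac pi (val x)).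
by rewrite mulrA -exprD subnKC.
Qed.

(** A perturbation of pi^e u by a multiple of pi^(e + c + 1) changes the unit
u by a multiple of pi^(c + 1). *)
Lemma dv_ord_ac e c x y : x != 0 -> ord x = e -> dv (e + c.+1) (x - y) ->
  [/\ y != 0, ord y = e & dv c.+1 (ac pi (val x) - ac pi (val y))].
Proof.
move=> x0 ox h; have [hu hx] := vdecomp x0; rewrite ox in hx.
have [z hz] : exists z, y = pi ^+ e * z.
  apply/dvP; rewrite -(dv_eqr (dv_leq (leq_addr _ _) h)) dvE ox leqnn orbT //.
move: h; rewrite hz {1}hx -mulrBr dv_piXM => h.
have uz : z \is a GRing.unit.
  by move: hu; rewrite !unitE (@dv_eqr 1 _ z) //; apply: dv_leq h.
by rewrite ac_piXu // ord_piXu // mulf_neq0 ?piX_neq0 // unit_neq0.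
Qed.

End Valuation.

(** * Digit expansions and sums over residue classes *)

Section Representatives.
Variables (K : localFieldType) (pi : valuation_ring K).
Hypothesis hpi : uniformizer pi.
Local Notation O := (valuation_ring K).
Local Notation F := (@residue_field K).
Implicit Types (e m N n : nat).

(** The digit 0 is lifted to 0, so that the expansion of a multiple of pi
begins with the digit 0 and the rest is the expansion of the quotient. *)
Definition lift_res (a : F) : O := if a == 0 then 0 else projT1 (cid (residue_surj a)).

Lemma lift_resK a : residue (lift_res a) = a.
Proof.
by rewrite /lift_res; case: eqP => [->|_]; [rewrite rmorph0|case: cid].
Qed.

Lemma lift_res0 : lift_res 0 = 0. Proof. by rewrite /lift_res eqxx. Qed.

(** The tuple of length N of residues is the expansion to order N in powers of
pi; such tuples represent the classes modulo pi^N exactly once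
([rep_surj], [rep_inj]). *)
Fixpoint rep (s : seq F) : O :=
  if s is a :: s' then lift_res a + pi * rep s' else 0.

Lemma residue_rep a s : residue (rep (a :: s)) = a.
Proof. by rewrite /= rmorphD rmorphM (residue_pi hpi) mul0r addr0 lift_resK. Qed.

Lemma rep_surj N (x : O) : exists s : N.-tuple F, dv N (x - rep s).
Proof.
elim: N x => [|N IH] x; first by exists [tuple]; rewrite dv0.
have /(dvP hpi)[y hy] : dv 1 (x - lift_res (residue x)) by rewrite dv1B lift_resK.
have [s hs] := IH y; exists [tuple of residue x :: s].
rewrite /= opprD addrA hy expr1 -mulrBr dv_piM //.
Qed.

Lemma rep_inj N (s t : N.-tuple F) : dv N (rep s - rep t) -> s = t.
Proof.
elim: N s t => [|N IH] s t; first by rewrite (tuple0 s) (tuple0 t).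
case/tupleP: s => a s; case/tupleP: t => b t => h.
have ab : a = b.
  rewrite -(residue_rep a s) -(residue_rep b t); apply/eqP.
  by rewrite -dv1B; apply: dv_leq h.
move: h; rewrite ab /= opprD addrACA subrr add0r -mulrBr.
by rewrite dv_piM // => /IH ->.
Qed.

Definition digits N (x : O) : N.-tuple F := projT1 (cid (rep_surj N x)).

Lemma digitsP N (x : O) : dv N (x - rep (digits N x)).
Proof. by rewrite /digits; case: cid. Qed.

Definition congv n N (x y : 'I_n -> O) := forall l, dv N (x l - y l).

Definition periodic n N (T : Type) (h : ('I_n -> O) -> T) :=
  forall x y, congv N x y -> h x = h y.

(** The classes of O^n modulo pi^N. *)
Definition grid n N := {ffun 'I_n -> N.-tuple F}.

Definition repv n N (a : grid n N) : 'I_n -> O := fun l => rep (a l).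

Definition digitsv n N (x : 'I_n -> O) : grid n N := [ffun l => digits N (x l)].

Lemma digitsvP n N (x : 'I_n -> O) : congv N x (repv (digitsv N x)).
Proof. by move=> l; rewrite /repv ffunE digitsP. Qed.

Lemma congv_sym n N (x y : 'I_n -> O) : congv N x y -> congv N y x.
Proof. by move=> h l; rewrite dv_sym. Qed.

Lemma congv_trans n N (y x z : 'I_n -> O) :
  congv N x y -> congv N y z -> congv N x z.
Proof. by move=> h1 h2 l; apply: dv_trans (h1 l) (h2 l). Qed.

Lemma congv_leq n N M (x y : 'I_n -> O) : (N <= M)%N -> congv M x y -> congv N x y.
Proof. by move=> h H l; apply: dv_leq (H l). Qed.

Lemma repv_inj n N (a b : grid n N) : congv N (repv a) (repv b) -> a = b.
Proof. by move=> h; apply/ffunP => l; apply: rep_inj; apply: h. Qed.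

Lemma card_grid n N : #|grid n N| = (qcard K ^ (N * n))%N.
Proof. by rewrite card_ffun card_tuple card_ord expnM. Qed.

(** A map that separates the classes of the grid permutes them, since the grid
is finite.  This is the change of variables formula of the whole development:
translations and the maps of [shiftv_inj] are instances. *)
Lemma sum_reindex (V : nmodType) n N (tau : ('I_n -> O) -> 'I_n -> O)
    (h : ('I_n -> O) -> V) :
  (forall a b : grid n N, congv N (tau (repv a)) (tau (repv b)) -> a = b) ->
  periodic N h ->
  \sum_(a : grid n N) h (tau (repv a)) = \sum_(a : grid n N) h (repv a).
Proof.
move=> inj ph; set th := fun a : grid n N => digitsv N (tau (repv a)).
have th_inj : injective th.
  move=> a b e; apply: inj; apply: congv_trans (digitsvP N _) _.
  rewrite -/(th a) e; exact: congv_sym (digitsvP N _).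
rewrite [RHS](reindex_inj th_inj) /=; apply: eq_bigr => a _.
exact/ph/digitsvP.
Qed.

Lemma sum_translate (V : nmodType) n N (w : 'I_n -> O) (h : ('I_n -> O) -> V) :
  periodic N h ->
  \sum_(a : grid n N) h (fun l => repv a l + w l) = \sum_(a : grid n N) h (repv a).
Proof.
apply: (@sum_reindex _ _ _ (fun x l => x l + w l)) => a b ab; apply: repv_inj => l.
by have := ab l; rewrite opprD addrACA subrr addr0.
Qed.

End Representatives.

(** * First-order Taylor expansion of polynomials *)

Section Taylor.
Variables (n : nat) (A : comNzRingType) (P : A) (x v : 'I_n -> A).
Implicit Types p q : mpoly n A.

Definition differential p : A := \sum_l meval x (mderiv l p) * v l.

Lemma differentialM p q :
  differential (p * q) = differential p * meval x q + meval x p * differential q.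
Proof.
rewrite mulr_suml mulr_sumr -big_split; apply: eq_bigr => l _ /=.
by rewrite mderivM mevalD !mevalM; ring.
Qed.

Lemma differentialD p q : differential (p + q) = differential p + differential q.
Proof.
by rewrite -big_split; apply: eq_bigr => l _ /=; rewrite mderivD mevalD mulrDl.
Qed.

Lemma differentialZ c p : differential (c *: p) = c * differential p.
Proof.
by rewrite mulr_sumr; apply: eq_bigr => l _ /=; rewrite mderivZ mevalZ mulrA.
Qed.

Lemma differentialX i : differential (mpolyX A (mnm1 i)) = v i.
Proof.
rewrite /differential (bigD1 i) //= big1 => [|l li]; rewrite mderivX mnm1E.
  have -> : mnm_sub (mnm1 i) (mnm1 i) = @mnm0 n.
    by apply/mnmP => j; rewrite mnmBE subnn mnm0E.
  by rewrite eqxx mevalZ mpolyX0 meval1 !mul1r addr0.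
by rewrite eq_sym (negPf li) scale0r meval0 mul0r.
Qed.

Lemma differential1 : differential 1 = 0.
Proof. by apply: big1 => l _; rewrite -mpolyC1 mderivC meval0 mul0r. Qed.

Let has_taylor p := exists r,
  meval (fun l => x l + P * v l) p =
  meval x p + P * differential p + P ^+ 2 * r.

(** The property is stable under products, because the product of the two
linear terms is divisible by P^2, and it holds for the variables. *)
Lemma taylor1 p : has_taylor p.
Proof.
have tM p1 p2 : has_taylor p1 -> has_taylor p2 -> has_taylor (p1 * p2).
  move=> [r hr] [s hs]; exists (differential p1 * differential p2
    + meval x p1 * s + r * (meval x p2 + P * differential p2 + P ^+ 2 * s)
    + P * differential p1 * s).
  by rewrite !mevalM hr hs differentialM; ring.
have t1 : has_taylor 1 by exists 0; rewrite differential1 !meval1; ring.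
have tX i : has_taylor (mpolyX A (mnm1 i)).
  by exists 0; rewrite differentialX !mevalXU; ring.
elim/mpolyind: p => [|c m p _ _ [r hr]].
  exists 0; rewrite (_ : differential 0 = 0) ?meval0; first by ring.
  by rewrite -(scale0r 1) differentialZ mul0r.
have [s hs] : has_taylor (mpolyX A m).
  rewrite mpolyXE_id; elim/big_ind : _ => // i _.
  by elim: (m i) => [|e IH]; rewrite ?expr0 // exprS; apply: tM.
exists (c * s + r).
by rewrite !mevalD !mevalZ hr hs differentialD differentialZ; ring.
Qed.

End Taylor.

Section Polynomials.
Variables (K : localFieldType) (pi : valuation_ring K) (n : nat).
Hypothesis hpi : uniformizer pi.
Local Notation O := (valuation_ring K).
Implicit Types (p : mpoly n O) (x y : 'I_n -> O).

Lemma meval_congr p e x y : congv e x y -> dv e (meval x p - meval y p).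
Proof.
move=> h; have /(_ _)/cid hv l : exists v, x l - y l = pi ^+ e * v.
  exact/(dvP hpi)/h.
have -> : meval x p = meval (fun l => y l + pi ^+ e * projT1 (hv l)) p.
  by apply: meval_eq => l; case: (hv l) => v /= <-; rewrite addrC subrK.
have [r ->] := taylor1 (pi ^+ e) y (fun l => projT1 (hv l)) p.
have E (V : zmodType) (a b c : V) : a + b + c - a = b + c.
  by rewrite -[a + b + c]addrA [a + (b + c)]addrC addrK.
by rewrite E expr2 -mulrA -mulrDr dv_piX.
Qed.

Lemma dv_taylor p e x (v : 'I_n -> O) :
  dv (e + e) (meval (fun l => x l + pi ^+ e * v l) p - meval x p
   - pi ^+ e * \sum_l meval x (mderiv l p) * v l).
Proof.
have [r ->] := taylor1 (pi ^+ e) x v p.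
have E (V : zmodType) (a b c : V) : a + b + c - a - b = c.
  by rewrite -[a + b + c]addrA [a + (b + c)]addrC addrK [b + c]addrC addrK.
by rewrite E -exprM mulnC mul2n -addnn dv_piX.
Qed.

End Polynomials.

(** * Newton polyhedra in integral directions *)

Section NewtonPolyhedron.
Variables (R : realType) (n : nat).
Implicit Types (k : 'I_n -> nat) (m : multinom n).

Definition weight k m : nat := (\sum_l k l * m l)%N.

Definition rvec k : 'rV[R]_n := \row_l (k l)%:R.

Lemma dotv_mnm k m : dotv (rvec k) (mnm_point R m) = (weight k m)%:R.
Proof.
rewrite /dotv /weight natr_sum; apply: eq_bigr => l _.
by rewrite !mxE natrM.
Qed.

(** The half-space contains m + R_+^n for every exponent m because k has
non-negative entries, and it is convex. *)
Lemma newton_halfspace (A : nzRingType) (h : mpoly n A) k (c : nat) :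
  (forall m, m \in msupp h -> (c <= weight k m)%N) ->
  newton R h `<=` [set x | c%:R <= dotv (rvec k) x].
Proof.
move=> hc; apply: smallest_sub => /=.
  move=> x y p; rewrite !inE /= => hx hy.
  have -> : dotv (rvec k) (conv p (x : convex_lmodType 'rV[R]_n) y) =
     p%:num * dotv (rvec k) x + (1 - p%:num) * dotv (rvec k) y.
    rewrite /dotv !mulr_sumr -big_split; apply: eq_bigr => l _ /=.
    by rewrite !mxE /unstable.onem; ring.
  rewrite [leLHS](_ : _ = p%:num * c%:R + (1 - p%:num) * c%:R); last by ring.
  by apply: lerD; apply: ler_wpM2l => //.
move=> x [m hm hx] /=; apply: (@le_trans _ _ (weight k m)%:R).
  by rewrite ler_nat hc.
rewrite -dotv_mnm /dotv; apply: ler_sum => l _.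
by apply: ler_wpM2l; [rewrite mxE|exact: hx].
Qed.

Lemma newton_mnm (A : nzRingType) (h : mpoly n A) m :
  m \in msupp h -> newton R h (mnm_point R m).
Proof. by move=> hm; apply: sub_gen_smallest; exists m. Qed.

Lemma dmin_newton (A : nzRingType) (h : mpoly n A) k (c : nat) m0 :
  (forall m, m \in msupp h -> (c <= weight k m)%N) ->
  m0 \in msupp h -> weight k m0 = c ->
  dmin (rvec k) (newton R h) = c%:R.
Proof.
move=> hc hm0 e0; rewrite /dmin; set S := image _ _.
have lb : lbound S c%:R by move=> _ [x hx <-]; apply: (newton_halfspace hc).
have Sc : S c%:R by exists (mnm_point R m0); rewrite ?dotv_mnm ?e0 //; apply: newton_mnm.
apply/eqP; rewrite eq_le; apply/andP; split.
  by apply: ge_inf => //; exists c%:R.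
by apply: lb_le_inf => //; exists c%:R.
Qed.

Lemma face_mnm (A : nzRingType) (h : mpoly n A) k (c : nat) m0 m :
  (forall m, m \in msupp h -> (c <= weight k m)%N) ->
  m0 \in msupp h -> weight k m0 = c -> m \in msupp h ->
  `[< face (rvec k) (newton R h) (mnm_point R m) >] = (weight k m == c).
Proof.
move=> hc hm0 e0 hm; apply/asboolP/eqP.
  by case=> _; rewrite dotv_mnm (dmin_newton hc hm0 e0) => /eqP; rewrite eqr_nat => /eqP.
by move=> e; split; [exact: newton_mnm|rewrite dotv_mnm (dmin_newton hc hm0 e0) e].
Qed.

(** A closed half-space that contains the polyhedron contains its closure. *)
Lemma closure_newton_diag (A : nzRingType) (h : mpoly n A) k (c : nat) (t : R) :
  (forall m, m \in msupp h -> (c <= weight k m)%N) ->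
  closure (newton R h) (const_mx t) -> c%:R <= t * (\sum_l k l)%:R.
Proof.
move=> hc ht.
have hcont : continuous (dotv (rvec k)).
  apply: (@continuous_big R _ +%R 0 predT _ _ _ (fun l (x : 'rV[R]_n) => rvec k 0 l * x 0 l)).
    exact: add_continuous.
  move=> l _ x; apply: (@continuous_comp _ _ _ (fun x : 'rV[R]_n => x 0 l) ( *%R (rvec k 0 l))).
    exact: coord_continuous.
  exact: mulrl_continuous.
have hcl : closed [set x : 'rV[R]_n | c%:R <= dotv (rvec k) x].
  apply: (@preimage_closed _ _ (dotv (rvec k)) [set y : R | c%:R <= y]).
    by move=> x _; exact: hcont.
  exact: closed_ge.
have := closureS (newton_halfspace hc) ht.
rewrite -(closure_id _).1 //=; congr (_ <= _).
rewrite /dotv natr_sum mulr_sumr; apply: eq_bigr => l _.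
by rewrite !mxE mulrC.
Qed.

End NewtonPolyhedron.

(** * Face polynomials as reductions of dilated polynomials *)

Section Dilation.
Variables (R : realType) (K : localFieldType) (pi : valuation_ring K) (n : nat).
Hypothesis hpi : uniformizer pi.
Local Notation O := (valuation_ring K).
Implicit Types (f g : mpoly n O) (k : 'I_n -> nat).

(** The number d(k, Gamma(f)) for an integral direction k. *)
Definition is_dmin k f (a : nat) :=
  (forall m, m \in msupp f -> (a <= weight k m)%N) /\
  (exists2 m, m \in msupp f & weight k m = a).

Lemma is_dmin_ex k f : f != 0 -> exists a, is_dmin k f a.
Proof.
move=> f0; have hs : exists a, has (fun m => weight k m == a) (msupp f).
  move: f0; rewrite -msupp_eq0; case: (msupp f) => [|m s] // _.
  by exists (weight k m); rewrite /= eqxx.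
case: (ex_minnP hs) => a /hasP[m hm /eqP e] hmin; exists a; split; last by exists m.
by move=> m' hm'; apply: hmin; apply/hasP; exists m'.
Qed.

(** The polynomial F with f(pi^k u) = pi^a F(u), where a = d(k, Gamma(f)). *)
Definition dilate k f (a : nat) : mpoly n O :=
  \sum_(m <- msupp f) (mcoeff m f * pi ^+ (weight k m - a)) *: mpolyX O m.

Lemma meval_dilate k f a (u : 'I_n -> O) : is_dmin k f a ->
  meval (fun l => pi ^+ k l * u l) f = pi ^+ a * meval u (dilate k f a).
Proof.
case=> ha _; rewrite (raddf_sum (meval u)) mulr_sumr mevalE.
rewrite big_seq [RHS]big_seq; apply: eq_bigr => m hm.
rewrite /= mevalZ mevalX -mulrA mulrCA; congr (_ * _).
rewrite mulrA -exprD subnKC ?ha //.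
rewrite /weight expr_sum -big_split; apply: eq_bigr => l _ /=.
by rewrite exprMn exprM.
Qed.

(** A monomial outside the face keeps a positive power of pi. *)
Lemma residue_dilate k f a : is_dmin k f a ->
  map_mpoly residue (dilate k f a) = map_mpoly residue (face_poly (rvec R k) f).
Proof.
case=> ha [m0 hm0 e0]; rewrite /dilate /face_poly !raddf_sum /=.
rewrite [RHS]big_mkcond /= big_seq [RHS]big_seq; apply: eq_bigr => m hm.
rewrite (face_mnm R ha hm0 e0 hm) !map_mpolyZ; case: eqP => [->|/eqP h].
  by rewrite subnn expr0 mulr1.
have : (0 < weight k m - a)%N by rewrite subn_gt0 ltn_neqAle eq_sym h ha.
case: (_ - a)%N => // e _.
by rewrite exprS rmorphM rmorphM (residue_pi hpi) mul0r mulr0 scale0r.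
Qed.

Lemma map_residueD (p q : mpoly n O) :
  map_mpoly residue (p + q) = map_mpoly residue p + map_mpoly residue q.
Proof. by rewrite raddfD. Qed.

Lemma map_residue0 : map_mpoly residue (0 : mpoly n O) = 0.
Proof. by rewrite raddf0. Qed.

Lemma residue_meval f (u : 'I_n -> O) :
  residue (meval u f) = meval (fun l => residue (u l)) (map_mpoly residue f).
Proof.
elim/mpolyind: f => [|c m p _ _ IH].
  by rewrite meval0 map_residue0 meval0 rmorph0.
rewrite mevalD rmorphD IH map_residueD mevalD; congr (_ + _).
rewrite mevalZ map_mpolyZ mevalZ mevalX map_mpolyX mevalX rmorphM rmorph_prod.
by congr (_ * _); apply: eq_bigr => l _; rewrite rmorphXn.
Qed.

Lemma residue_mderiv f l : map_mpoly residue (mderiv l f) =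
  mderiv l (map_mpoly residue f).
Proof.
elim/mpolyind: f => [|c m p _ _ IH].
  by rewrite mderiv0 map_residue0 mderiv0.
rewrite mderivD !map_residueD mderivD IH; congr (_ + _).
by rewrite mderivZ !map_mpolyZ map_mpolyX mderivZ !mderivX map_mpolyZ map_mpolyX rmorph_nat.
Qed.

Section Nondegenerate.
Variables (f g : mpoly n O).
Hypothesis hnd : newton_nondegenerate R f g.
Variables (k : 'I_n -> nat) (a b : nat).
Hypotheses (ha : is_dmin k f a) (hb : is_dmin k g b).
Variable u : 'I_n -> O.
Hypothesis hu : forall l, u l \is a GRing.unit.

Let Phi (i : 'I_2) : mpoly n O := if i == 0 then dilate k f a else dilate k g b.

(** The non-degeneracy condition says that the Jacobian matrix over the residue
field has full row rank; the columns of w lift a right inverse of it. *)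
Lemma nondegenerate_lift (I : {set 'I_2}) : I != finset.set0 ->
  (forall i, dv 1 (meval u (Phi i)) = (i \in I)) ->
  exists w : 'I_n -> 'I_2 -> O, forall i e, i \in I -> e \in I ->
    dv 1 (\sum_l meval u (mderiv l (Phi i)) * w l e - (i == e)%:R).
Proof.
move=> I0 hI; pose z l := residue (u l).
pose hbar (i : 'I_2) := map_mpoly residue (face_poly (rvec R k) (if i == 0 then f else g)).
have hPhi i : map_mpoly residue (Phi i) = hbar i.
  rewrite /Phi /hbar; case: ifP => _; exact: residue_dilate.
have hz i : meval z (hbar i) = 0 <-> i \in I.
  rewrite -hI -hPhi -residue_meval -residue_eq0; split; by move/eqP.
have k0 j : 0 <= rvec R k 0 j by rewrite mxE.
have z0 j : z j != 0 by rewrite /z -unit_residue.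
have := hnd k0 I0 z0 hz; set A := (\matrix_(_, _) _) => rA.
have fA : row_free A by rewrite /row_free rA.
have [i0 hi0] : exists i0, i0 \in I by apply/set0Pn.
exists (fun l e => lift_res (pinvmx A l (enum_rank_in hi0 e))) => i e hi he.
rewrite dv1B rmorph_sum /= rmorph_nat; apply/eqP.
have := mulmxVp fA => /matrixP /(_ (enum_rank_in hi0 i) (enum_rank_in hi0 e)).
rewrite !mxE (inj_in_eq (@enum_rank_in_inj _ _ _ _ _ _)) // => <-.
apply: eq_bigr => l _; rewrite rmorphM lift_resK; congr (_ * _).
by rewrite /A mxE enum_rankK_in // residue_meval residue_mderiv hPhi.
Qed.

End Nondegenerate.
End Dilation.

(** * Characters of the unit group and sums over shells *)

Section TupleSums.
Variables (V : nmodType) (F : finType).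

Lemma sum_tuple_cons N (h : seq F -> V) :
  \sum_(s : N.+1.-tuple F) h s = \sum_(a : F) \sum_(s : N.-tuple F) h (a :: s).
Proof.
rewrite pair_big (reindex (fun p : F * N.-tuple F => [tuple of p.1 :: p.2])) //=.
exists (fun s : N.+1.-tuple F => (thead s, [tuple of behead s])) => [[a s] _|s _].
  by rewrite theadE; congr (_, _); apply: val_inj.
by apply: val_inj; rewrite /= [in RHS](tuple_eta s).
Qed.

End TupleSums.

Section Characters.
Variables (R : realType) (K : localFieldType) (pi : valuation_ring K).
Hypothesis hpi : uniformizer pi.
Local Notation O := (valuation_ring K).
Local Notation F := (@residue_field K).
Local Notation C := R[i].
Implicit Types (chi : O -> C) (x y u v : O) (c e J N : nat).

(** The exponent is c + 1, so that it is always positive. *)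
Definition has_conductor chi c : Prop :=
  [/\ forall u v, u \is a GRing.unit -> v \is a GRing.unit ->
        chi (u * v) = chi u * chi v,
      forall u, u \is a GRing.unit -> `|chi u| = 1 &
      forall v, dv c.+1 (v - 1) -> chi v = 1].

(** On the unit circle, 1 - Re(z^2) = 2 (1 - Re z) (1 + Re z).  If every power
of z has a positive real part, squaring at least doubles 1 - Re z, which
stays below 1; so it is 0. *)
Lemma unit_circle_small (z : C) : `|z| = 1 ->
  (forall e, `|z ^+ e - 1| < 1) -> z = 1.
Proof.
move=> z1 hz; have hn (w : C) : `|w| = 1 -> complex.Re w ^+ 2 + complex.Im w ^+ 2 = 1.
  case: w => x y /eqP; rewrite normc_def eq_complex /= => /andP[/eqP h _].
  by rewrite -[LHS]sqr_sqrtr ?h ?expr1n // addr_ge0 ?sqr_ge0.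
have hre (w : C) : `|w - 1| < 1 -> 0 < complex.Re w.
  case: w => x y; rewrite normc_def ltcE /= => /andP[_ h].
  have h2 : (x - 1) ^+ 2 + (y + - 0) ^+ 2 < 1.
    rewrite -[ltRHS](expr1n _ 2%N) -[ltLHS]sqr_sqrtr ?addr_ge0 ?sqr_ge0 //.
    by rewrite ltr_pXn2r // ?nnegrE ?sqrtr_ge0.
  have : 0 <= (y + - 0) ^+ 2 by rewrite sqr_ge0.
  nra.
have hre1 (w : C) : `|w| = 1 -> complex.Re w <= 1.
  move/hn; have := sqr_ge0 (complex.Im w); nra.
pose s e := 1 - complex.Re (z ^+ (2 ^ e)).
have zn e : `|z ^+ e| = 1 by rewrite normrX z1 expr1n.
have s1 e : s e < 1 by rewrite /s ltrBlDr ltrDl hre.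
have s2 e : 2 * s e <= s e.+1.
  rewrite /s expnSr exprM; move: (zn (2 ^ e)%N) (hre _ (hz (2 ^ e)%N)).
  move: (hre1 _ (zn (2 ^ e)%N)); set w := z ^+ _ => w1 /hn wn w0.
  have -> : complex.Re (w ^+ 2) = complex.Re w ^+ 2 - complex.Im w ^+ 2.
    by case: (w) => x y; rewrite expr2.
  nra.
have s3 e : 2 ^+ e * s 0%N <= s e.
  elim: e => [|e IH]; first by rewrite mul1r.
  by rewrite exprS -mulrA; apply: le_trans (s2 e); rewrite ler_pM2l.
have s0 : s 0%N <= 0.
  rewrite leNgt; apply/negP => s0.
  have [e he] : exists e, (s 0%N)^-1 < 2 ^+ e.
    exists (Num.truncn (s 0%N)^-1).+1; apply: (lt_trans (truncnS_gt _)).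
    by rewrite -natrX ltr_nat ltn_expl.
  have := le_lt_trans (s3 e) (s1 e); rewrite -ltr_pdivlMr // mul1r => /lt_trans/(_ he).
  by rewrite ltxx.
have := hre1 _ z1; have := hn _ z1; move: s0; rewrite /s expr1.
case: (z) => x y /= h1 h2 h3; have ex : x = 1 by lra.
by apply/eqP; rewrite eq_complex /= ex eqxx -sqrf_eq0 /=; apply/eqP; nra.
Qed.

(** The neighbourhoods 1 + pi^m O of 1 are subgroups, and the open disc of
radius 1 about 1 contains no non-trivial subgroup of the circle. *)
Lemma conductor_exists chi : is_character chi -> exists c, has_conductor chi c.
Proof.
case=> hM hn hc _; have c1 : chi 1 = 1.
  have := hM _ _ (unitr1 _) (unitr1 _); rewrite mulr1 => h.
  have : chi 1 != 0 by rewrite -normr_eq0 hn ?unitr1 // oner_eq0.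
  by move=> n0; apply: (mulfI n0); rewrite -h mulr1.
have [m hm] := hc 1 1 (unitr1 _) ltr01.
exists `|m|%N; split=> // v hv.
have uv e : dv `|m|.+1 (v ^+ e - 1).
  elim: e => [|e IH]; first by rewrite expr0 subrr dv_0.
  rewrite exprS (_ : v * v ^+ e - 1 = v * (v ^+ e - 1) + (v - 1)); last by ring.
  by rewrite dvD // dvMl.
have ux x : dv `|m|.+1 (x - 1) -> x \is a GRing.unit.
  move=> hx; rewrite unitE (@dv_eqr _ 1 _ 1) -?unitE ?unitr1 //.
  exact: dv_leq hx.
have vX e : chi (v ^+ e) = chi v ^+ e.
  elim: e => [|e IH]; first by rewrite !expr0.
  by rewrite !exprS hM ?IH ?ux.
apply: unit_circle_small => [|e]; first by rewrite hn // ux.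
rewrite -vX -[X in _ - X]c1; apply: hm; first exact: ux.
have := uv e; rewrite /dv /vge -rmorphB => /orP[->//|h]; apply/orP; right.
by apply: le_trans h; lia.
Qed.

Lemma has_conductorV chi c : has_conductor chi c -> has_conductor (fun z => (chi z)^-1) c.
Proof.
case=> hM hn hc; split=> [u v hu hv|u hu|v hv].
- by rewrite hM // invfM.
- by rewrite normfV hn // invr1.
- by rewrite hc // invr1.
Qed.

(** The coefficient of q^(-sJ) in chi(ac y) |y|^s. *)
Definition shell chi J y : C :=
  if (y != 0) && (ord y == J) then chi (ac pi (val y)) else 0.

Section Shell.
Variables (chi : O -> C) (c : nat).
Hypothesis hchi : has_conductor chi c.

Lemma chi_congr u v : u \is a GRing.unit -> dv c.+1 (u - v) -> chi u = chi v.
Proof.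
case: hchi => hM _ hc hu h; have hv : v \is a GRing.unit.
  by move: hu; rewrite !unitE (@dv_eqr _ 1 _ v) //; apply: dv_leq h.
rewrite -(divrK hv u) hM ?rpredM ?rpredV //.
rewrite (hc (u / v)) ?mul1r // -(divrr hv) -mulrBl; exact: dvMr.
Qed.

Lemma shell_norm J y : `|shell chi J y| <= 1.
Proof.
case: hchi => _ hn _; rewrite /shell; case: ifP => [/andP[y0 _]|_].
  by rewrite hn //; case: (vdecomp hpi y0).
by rewrite normr0 ler01.
Qed.

Lemma shell_piXu J a u : u \is a GRing.unit ->
  shell chi J (pi ^+ a * u) = if J == a then chi u else 0.
Proof.
move=> hu; rewrite /shell mulf_neq0 ?piX_neq0 ?unit_neq0 //=.
by rewrite ord_piXu // ac_piXu // eq_sym.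
Qed.

Lemma shell0 J : shell chi J 0 = 0. Proof. by rewrite /shell eqxx. Qed.

Lemma shell_scale J a y :
  shell chi J (pi ^+ a * y) = if (a <= J)%N then shell chi (J - a) y else 0.
Proof.
have [->|y0] := eqVneq y 0; first by rewrite mulr0 !shell0 if_same.
have [hu ->] := vdecomp hpi y0; rewrite mulrA -exprD !shell_piXu //.
case: leqP => h; last by case: eqP => // e; move: h; rewrite e; lia.
by congr (if _ then _ else _); apply/eqP/eqP; lia.
Qed.

Lemma shell_congr J x y : dv (J + c.+1) (x - y) -> shell chi J x = shell chi J y.
Proof.
wlog: x y / (x != 0) && (ord x == J) => [hw|/andP[x0 /eqP ox] h].
  move=> h; case hx: ((x != 0) && (ord x == J)); first exact: hw.
  case hy: ((y != 0) && (ord y == J)); first by rewrite (hw y x) // dv_sym.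
  by rewrite /shell hx hy.
have [y0 oy hac] := dv_ord_ac hpi x0 ox h.
rewrite /shell x0 y0 ox oy eqxx /=; apply: chi_congr => //.
by case: (vdecomp hpi x0).
Qed.

Lemma shell_unit J u y : u \is a GRing.unit ->
  shell chi J (u * y) = chi u * shell chi J y.
Proof.
move=> hu; have [->|y0] := eqVneq y 0; first by rewrite mulr0 shell0 mulr0.
have [hv ->] := vdecomp hpi y0; rewrite mulrCA !shell_piXu ?rpredM //.
by case: eqP; rewrite ?mulr0 //; case: hchi => hM _ _ _; rewrite hM.
Qed.

Lemma shell_piX_congr J a u v : u \is a GRing.unit -> dv c.+1 (u - v) ->
  shell chi J (pi ^+ a * u) = shell chi J (pi ^+ a * v).
Proof.
move=> hu h; have hv : v \is a GRing.unit.
  by move: hu; rewrite !unitE (@dv_eqr _ 1 _ v) //; apply: dv_leq h.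
by rewrite !shell_piXu // (chi_congr hu h).
Qed.

Variable kappa : C.

(** The coefficient of X^J in (1 - kappa X) sum_j (shell j y) X^j. *)
Definition dshell J y : C :=
  shell chi J y - kappa * (if J is J'.+1 then shell chi J' y else 0).

Lemma dshell_norm J y : `|kappa| <= 1 -> `|dshell J y| <= 2.
Proof.
move=> hk; apply: (le_trans (ler_normB _ _)); rewrite -[2]/(1 + 1).
apply: lerD; first exact: shell_norm.
rewrite normrM -[leRHS]mulr1; apply: ler_pM => //.
by case: J => [|J]; rewrite ?normr0 ?ler01 ?shell_norm.
Qed.

Lemma dshell_scale J a y : (a < J)%N ->
  dshell J (pi ^+ a * y) = dshell (J - a) y.
Proof.
move=> aJ; rewrite /dshell shell_scale ltnW //; congr (_ - _ * _).
case: J aJ => [//|J]; rewrite ltnS => aJ.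
by rewrite shell_scale aJ subSn.
Qed.

Lemma dshell_congr J x y : dv (J + c.+1) (x - y) -> dshell J x = dshell J y.
Proof.
move=> h; rewrite /dshell (shell_congr h); congr (_ - _ * _).
case: J h => [//|J] h; apply: shell_congr; apply: dv_leq h.
by rewrite addSn.
Qed.

Lemma dshell_small J m y : ~~ dv m y -> (m < J)%N -> dshell J y = 0.
Proof.
rewrite dvE negb_or -ltnNge => /andP[y0 ym] mJ.
case: J mJ => [//|J] mJ; rewrite /dshell /shell y0 /=.
have -> : (ord y == J.+1) = false by apply/eqP; lia.
have -> : (ord y == J) = false by apply/eqP; lia.
by rewrite mulr0 subr0.
Qed.

(** The ratio of the sums of chi(ac y) over consecutive shells: 1/q, because the
angular component is distributed in the same way in all shells, or 0 when the
sums vanish. *)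
Definition cancelling : Prop :=
  kappa = (qcard K)%:R^-1 \/ (kappa = 0 /\ exists2 u, u \is a GRing.unit & chi u != 1).

Lemma sum_rep_reindex L (tau : O -> O) (h : O -> C) :
  (forall x y, dv L (tau x - tau y) -> dv L (x - y)) ->
  (forall x y, dv L (x - y) -> h x = h y) ->
  \sum_(s : L.-tuple F) h (tau (rep pi s)) = \sum_(s : L.-tuple F) h (rep pi s).
Proof.
move=> inj ph; pose th (s : L.-tuple F) := digits hpi L (tau (rep pi s)).
have thP (s : L.-tuple F) : dv L (tau (rep pi s) - rep pi (th s)) by apply: digitsP.
have th_inj : injective th.
  move=> s t e; apply: (rep_inj hpi); apply: inj.
  by apply: dv_trans (thP s) _; rewrite e dv_sym thP.
by rewrite [RHS](reindex_inj th_inj) /=; apply: eq_bigr => s _; apply: ph.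
Qed.

Lemma sum_rep_refine L (h : O -> C) :
  (forall x y, dv L (x - y) -> h x = h y) ->
  \sum_(s : L.+1.-tuple F) h (rep pi s) =
  (qcard K)%:R * \sum_(s : L.-tuple F) h (rep pi s).
Proof.
elim: L h => [|L IH] h ph.
  rewrite (sum_tuple_cons _ (fun s => h (rep pi s))).
  rewrite (eq_bigr (fun _ => \sum_(s : 0.-tuple F) h (rep pi s))).
    by rewrite sumr_const [RHS]mulr_natl.
  by move=> a _; apply: eq_bigr => s _; apply: ph; exact: dv0.
rewrite (sum_tuple_cons _ (fun s => h (rep pi s))) [in RHS](sum_tuple_cons _ (fun s => h (rep pi s))).
rewrite mulr_sumr; apply: eq_bigr => a _.
apply: (IH (fun y => h (lift_res a + pi * y))) => x y xy; apply: ph.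
rewrite opprD addrACA subrr add0r -mulrBr; by rewrite dv_piM.
Qed.

(** The elements of order J + 1 are the products of pi with those of order J. *)
Lemma sum_shell_pi L J : 
  \sum_(s : L.+1.-tuple F) shell chi J.+1 (rep pi s) =
  \sum_(s : L.-tuple F) shell chi J (rep pi s).
Proof.
rewrite (sum_tuple_cons _ (fun s => shell chi J.+1 (rep pi s))) (bigD1 0) //=.
rewrite [X in _ + X]big1 ?addr0 => [|a a0].
  apply: eq_bigr => s _; rewrite lift_res0 add0r.
  by rewrite -[X in X * _]expr1 shell_scale /= subSS subn0.
apply: big1 => s _; have hu : rep pi (a :: s) \is a GRing.unit.
  by rewrite unit_residue residue_rep.
by rewrite /shell ord_unit // andbF.
Qed.

(** If kappa = 1/q, the shell of order J - 1 is q times as large as the shell of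
order J, with the same distribution of the angular component.  If kappa = 0,
multiplication by a unit u with chi(u) different from 1 permutes the shell and
multiplies the sum by chi(u). *)
Lemma sum_dshell J L : cancelling -> (0 < J)%N -> (J + c.+1 <= L)%N ->
  \sum_(s : L.-tuple F) dshell J (rep pi s) = 0.
Proof.
case=> [hk|[hk [u hu cu]]] J0 JL.
  case: J L J0 JL => [//|J] [|L] // _ JL; rewrite sumrB -mulr_sumr sum_shell_pi.
  rewrite (sum_rep_refine (h := shell chi J)) => [|x y h].
    rewrite hk mulKf ?subrr // pnatr_eq0 -lt0n.
    by apply/card_gt0P; exists 0.
  by apply: shell_congr; apply: dv_leq h; move: JL; rewrite addSn ltnS.
rewrite (eq_bigr (fun s : L.-tuple F => shell chi J (rep pi s))) => [|s _]; last first.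
  by rewrite /dshell hk mul0r subr0.
set S := \sum_(s : _) _; have : S = chi u * S.
  rewrite {1}/S -(sum_rep_reindex (tau := fun y => u * y) (h := shell chi J) (L := L)).
  - by rewrite /S mulr_sumr; apply: eq_bigr => s _; rewrite shell_unit.
  - by move=> x y; rewrite -mulrBr => /(dvMl u^-1); rewrite mulKr.
  - by move=> x y h; apply: shell_congr; apply: dv_leq h.
move/eqP; rewrite -{1}[S]mul1r -subr_eq0 -mulrBl mulf_eq0 subr_eq0 eq_sym (negPf cu).
by move/eqP.
Qed.

End Shell.
End Characters.

(** * Equidistribution along transversal directions *)

Section Equidistribution.
Variables (R : realType) (K : localFieldType) (pi : valuation_ring K).
Hypothesis hpi : uniformizer pi.
Local Notation O := (valuation_ring K).
Local Notation C := R[i].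
Variables (n d m : nat) (Phi : 'I_d -> mpoly n O).
Variables (u : 'I_n -> O) (W : 'I_n -> 'I_d -> O).
Hypothesis hW : forall i e,
  dv 1 (\sum_l meval u (mderiv l (Phi i)) * W l e - (i == e)%:R).

Definition shiftv (t : 'I_d -> O) : 'I_n -> O :=
  fun l => u l + pi ^+ m.+1 * \sum_e W l e * t e.

Lemma shiftv_congr1 t : congv 1 (shiftv t) u.
Proof.
move=> l; rewrite /shiftv [X in X - _]addrC addrK.
by apply: dv_leq (dv_piX hpi m.+1 _).
Qed.

Lemma residue_dot (D D' : 'I_n -> O) i (v : 'I_d -> O) :
  (forall l, residue (D l) = residue (D' l)) ->
  (forall e, residue (\sum_l D' l * W l e) = residue (i == e)%:R) ->
  residue (\sum_l D l * (\sum_e W l e * v e)) = residue (v i).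
Proof.
move=> hD hW'; rewrite rmorph_sum /=.
under eq_bigr do rewrite rmorphM hD -rmorphM mulr_sumr rmorph_sum /=.
rewrite exchange_big /= (bigD1 i) //= [X in _ + X]big1 ?addr0 => [|e ei].
  have := hW' i; rewrite eqxx rmorph1 rmorph_sum => hi.
  rewrite -[RHS]mul1r -hi mulr_suml; apply: eq_bigr => l _ /=.
  by rewrite !rmorphM mulrA.
have := hW' e; rewrite eq_sym (negPf ei) rmorph0 rmorph_sum => he.
transitivity ((\sum_l residue (D' l * W l e)) * residue (v e)); last by rewrite he mul0r.
rewrite mulr_suml; apply: eq_bigr => l _ /=.
by rewrite !rmorphM mulrA.
Qed.

Lemma residue_jacobian x i (v : 'I_d -> O) : congv 1 x u ->
  residue (\sum_l meval x (mderiv l (Phi i)) * (\sum_e W l e * v e)) = residue (v i).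
Proof.
move=> hx; apply: (@residue_dot _ (fun l => meval u (mderiv l (Phi i)))) => [l|e].
  by apply/eqP; rewrite -dv1B; apply: (meval_congr hpi).
by apply/eqP; rewrite -dv1B.
Qed.

(** Let pi^e be the exact power dividing the difference of two parameters.  The
difference of the values is, to first order, the Jacobian applied to the
velocity, that is pi^(m + 1 + e) times a vector that is not 0 modulo pi, and
the remainder is divisible by pi^(2 (m + 1 + e)).  So the values separate the
parameters. *)
Lemma shiftv_inj L (t t' : 'I_d -> O) :
  (forall i, dv (m.+1 + L) (meval (shiftv t) (Phi i) - meval (shiftv t') (Phi i))) ->
  congv L t t'.
Proof.
move=> H; suff : forall e, (e <= L)%N -> congv e t t' by apply.
elim=> [|e IH] eL; first by move=> i; exact: dv0.
have hv i : exists v, t i - t' i = pi ^+ e * v by apply/(dvP hpi)/IH/ltnW.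
have {}hv i := cid (hv i); pose v i := projT1 (hv i).
have tv i : t i = t' i + pi ^+ e * v i.
  by rewrite /v; case: (hv i) => w /= <-; rewrite addrC subrK.
have hx : shiftv t =1 (fun l => shiftv t' l + pi ^+ (m.+1 + e) * \sum_i W l i * v i).
  move=> l; rewrite /shiftv -addrA; congr (_ + _); rewrite exprD -mulrA -mulrDr; congr (_ * _).
  rewrite mulr_sumr -big_split; apply: eq_bigr => i _ /=.
  by rewrite tv mulrDr mulrCA.
move=> i; rewrite tv [X in X - _]addrC addrK -[e.+1]addn1 dv_piXM //.
have := dv_taylor hpi (Phi i) (m.+1 + e) (shiftv t') (fun l => \sum_i W l i * v i).
rewrite -(meval_eq _ hx) => /(@dv_leq _ (m.+1 + e + 1)%N).
have -> : (m.+1 + e + 1 <= m.+1 + e + (m.+1 + e))%N by lia.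
move=> /(_ isT) h1; have h2 : dv (m.+1 + e + 1) (meval (shiftv t) (Phi i) - meval (shiftv t') (Phi i)).
  by apply: dv_leq (H i); lia.
rewrite (dv_eqr (x := _ - _) h1) in h2.
rewrite dv_piXM // -residue_eq0 residue_jacobian in h2; last exact: shiftv_congr1.
by rewrite -residue_eq0.
Qed.

(** By [shiftv_inj] the map from parameters to values, rescaled by
pi^(m + 1), is injective on the grid, hence bijective. *)
Lemma equidistribution L (h : ('I_d -> O) -> C) : periodic (m.+1 + L) h ->
  \sum_(t : grid K d L) h (fun i => meval (shiftv (repv pi t)) (Phi i)) =
  \sum_(t : grid K d L) h (fun i => meval u (Phi i) + pi ^+ m.+1 * repv pi t i).
Proof.
move=> ph.
have hz t i : exists z, meval (shiftv t) (Phi i) - meval u (Phi i) = pi ^+ m.+1 * z.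
  apply/(dvP hpi)/(meval_congr hpi) => l; rewrite /shiftv [X in X - _]addrC addrK.
  exact: dv_piX.
have {}hz t i := cid (hz t i); pose z t i := projT1 (hz t i).
have zE t i : meval (shiftv t) (Phi i) = meval u (Phi i) + pi ^+ m.+1 * z t i.
  by rewrite /z; case: (hz t i) => w /= <-; rewrite addrC subrK.
pose h' y := h (fun i => meval u (Phi i) + pi ^+ m.+1 * y i).
rewrite -[RHS](sum_reindex hpi (tau := z) (h := h')).
- apply: eq_bigr => t _; rewrite /h'; congr h; apply/funext => i; exact: zE.
- move=> a b hab; apply: (repv_inj hpi); apply: shiftv_inj => i.
  by rewrite !zE opprD addrACA subrr add0r -mulrBr dv_piXM.
- move=> x y xy; apply: ph => i.
  by rewrite opprD addrACA subrr add0r -mulrBr dv_piXM.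
Qed.

End Equidistribution.

Section GridProducts.
Variables (R : realType) (K : localFieldType) (pi : valuation_ring K).
Local Notation O := (valuation_ring K).
Local Notation F := (@residue_field K).
Local Notation C := R[i].

Lemma sum_grid_prod d L (h : 'I_d -> O -> C) :
  \sum_(t : grid K d L) \prod_i h i (repv pi t i) =
  \prod_i \sum_(s : L.-tuple F) h i (rep pi s).
Proof. by rewrite bigA_distr_bigA. Qed.

End GridProducts.

(** * Cancellation on a class *)

Section LocalCancellation.
Variables (R : realType) (K : localFieldType) (pi : valuation_ring K).
Hypothesis hpi : uniformizer pi.
Local Notation O := (valuation_ring K).
Local Notation F := (@residue_field K).
Local Notation C := R[i].
Variables (n : nat) (f g : mpoly n O) (chi chi' : O -> C) (c : nat) (kappa Y : C).
Hypotheses (hchi : has_conductor chi c) (hchi' : has_conductor chi' c).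
Hypothesis hnd : newton_nondegenerate R f g.
Hypothesis hk : cancelling chi kappa.
Hypothesis hkappa : `|kappa| <= 1.
Hypothesis hY : `|Y| <= 1.

(** The truncation of chi'(ac y) Y^(ord y) at order N.  It is constant on classes
modulo pi^(N + c + 1), unlike the full function, whose values near 0 depend
on arbitrarily many digits. *)
Definition trunc_char N (y : O) : C := \sum_(i < N) Y ^+ i * shell pi chi' i y.

Lemma trunc_char_congr N x y : dv (N + c.+1) (x - y) -> trunc_char N x = trunc_char N y.
Proof.
move=> h; apply: eq_bigr => i _; rewrite (shell_congr hpi hchi' (x := x) (y := y)) //.
by apply: dv_leq h; rewrite leq_add2r ltnW.
Qed.

Lemma trunc_char_unit N b u v : u \is a GRing.unit -> dv c.+1 (u - v) ->
  trunc_char N (pi ^+ b * u) = trunc_char N (pi ^+ b * v).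
Proof.
by move=> hu huv; apply: eq_bigr => i _; rewrite (shell_piX_congr hpi hchi' _ _ hu huv).
Qed.

Lemma trunc_charE N y : trunc_char N y =
  if (y != 0) && (ord y < N)%N then Y ^+ ord y * chi' (ac pi (val y)) else 0.
Proof.
case: ifP => [/andP[y0 yN]|h]; last first.
  apply: big1 => i _; rewrite /shell; case: ifP => [/andP[y0 /eqP oy]|]; rewrite ?mulr0 //.
  by move: h; rewrite y0 oy ltn_ord.
rewrite /trunc_char (bigD1 (Ordinal yN)) //= big1 ?addr0 => [|i].
  by rewrite /shell y0 eqxx.
rewrite -val_eqE /= /shell => /negPf h.
by rewrite [ord y == _]eq_sym h andbF mulr0.
Qed.

Lemma trunc_char_norm N y : `|trunc_char N y| <= 1.
Proof.
rewrite trunc_charE; case: ifP => [/andP[y0 _]|_]; last by rewrite normr0 ler01.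
case: hchi' => _ hn _; rewrite normrM normrX hn ?mulr1 ?exprn_ile1 //.
by case: (vdecomp hpi y0).
Qed.

(** The contribution of x to the coefficient of X^j. *)
Definition shell_term j N (x : 'I_n -> O) : C :=
  dshell pi chi kappa j (meval x f) * trunc_char N (meval x g).

Lemma shell_term_norm j N x : `|shell_term j N x| <= 2.
Proof.
rewrite /shell_term normrM -[leRHS]mulr1; apply: ler_pM => //.
  exact: (dshell_norm hpi hchi).
exact: trunc_char_norm.
Qed.

Lemma shell_term_periodic j N M : (j + N + c.+1 <= M)%N -> periodic M (shell_term j N).
Proof.
move=> hM x y xy; rewrite /shell_term.
rewrite (dshell_congr hpi hchi kappa (x := meval x f) (y := meval y f)).
  rewrite (trunc_char_congr (x := meval x g) (y := meval y g)) //.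
  by apply: dv_leq (meval_congr hpi g xy); lia.
by apply: dv_leq (meval_congr hpi f xy); lia.
Qed.

(** Either the coset lies in pi^(m + 1) O, and rescaling reduces the sum to
[sum_dshell], or the order is constant on the coset and too small. *)
Lemma sum_dshell_coset m J L y : (m.+1 < J)%N -> (J + c.+1 <= L)%N ->
  \sum_(s : L.-tuple F) dshell pi chi kappa J (y + pi ^+ m.+1 * rep pi s) = 0.
Proof.
move=> mJ JL; have [/(dvP hpi)[z ->]|ny] := boolP (dv m.+1 y); last first.
  apply: big1 => s _; apply: (@dshell_small _ _ _ _ _ _ m.+1) => //.
  apply: contra ny => h; rewrite -[y](addrK (pi ^+ m.+1 * rep pi s)).
  by rewrite dvB // dv_piX.
rewrite -[RHS](sum_dshell hpi hchi hk (J := J - m.+1) (L := L)); [|lia|lia].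
rewrite -[RHS](sum_rep_reindex hpi (tau := fun y => z + y) (L := L)).
- by apply: eq_bigr => s _; rewrite -mulrDr (dshell_scale hpi).
- by move=> x x'; rewrite opprD addrACA subrr add0r.
- move=> x x' h; apply: (dshell_congr hpi hchi); apply: dv_leq h; lia.
Qed.

Section Class.
Variables (k : 'I_n -> nat) (a b : nat) (u : 'I_n -> O).
Hypotheses (ha : is_dmin k f a) (hb : is_dmin k g b).
Hypothesis hu : forall l, u l \is a GRing.unit.
Variables (j N : nat).
Hypothesis hj : (a + c.+1 < j)%N.

Local Notation Fk := (dilate pi k f a).
Local Notation Gk := (dilate pi k g b).

Lemma shell_term_dilate x : shell_term j N (fun l => pi ^+ k l * x l) =
  dshell pi chi kappa (j - a) (meval x Fk) * trunc_char N (pi ^+ b * meval x Gk).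
Proof.
rewrite /shell_term (meval_dilate pi x ha) (meval_dilate pi x hb) (dshell_scale hpi) //.
lia.
Qed.

Lemma dv1_meval (p : mpoly n O) x x' : congv 1 x x' -> dv 1 (meval x p) = dv 1 (meval x' p).
Proof. by move=> h; apply: dv_eqr; apply: (meval_congr hpi). Qed.

Lemma jacobian_congr (p : mpoly n O) (w : 'I_n -> O) (z : O) x x' : congv 1 x x' ->
  dv 1 (\sum_l meval x (mderiv l p) * w l - z) ->
  dv 1 (\sum_l meval x' (mderiv l p) * w l - z).
Proof.
move=> hx; apply: dv_trans; rewrite -sumrB; apply: dv_sum => l _.
rewrite -mulrBl dvMr //; apply: (meval_congr hpi) => i; rewrite dv_sym; exact: hx.
Qed.

(** The sum is evaluated by [equidistribution] along directions transversal to
the zeros modulo pi.  The directions depend on the class only, not on its point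
x, so that the whole class can be averaged along them. *)
Lemma local_cancellation L : (j + N + c.+1 <= L)%N ->
  exists d m (W : 'I_n -> 'I_d -> O), forall x, congv 1 x u ->
    \sum_(t : grid K d L)
      shell_term j N (fun l => pi ^+ k l * shiftv pi m x W (repv pi t) l) = 0.
Proof.
move=> hL; have [fu|fu] := boolP (dv 1 (meval u Fk)); last first.
  (* F(u) is a unit: the order of f is constant, and no translation is needed *)
  exists 0%N, 0%N, (fun _ _ => 0) => x hx; apply: big1 => t _.
  rewrite shell_term_dilate (@dshell_small _ _ _ _ _ _ 1%N) ?mul0r //; last by lia.
  rewrite (@dv1_meval _ _ u) //; apply: congv_trans hx; exact: shiftv_congr1.
have [gu|gu] := boolP (dv 1 (meval u Gk)).
  (* F and G both vanish modulo pi: translate by pi along two directions, so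
     that (F, G) runs over a coset of pi O^2 *)
  have [|i|w hw] := nondegenerate_lift hpi hnd ha hb hu (I := [set: 'I_2]).
  - by apply/set0Pn; exists 0; rewrite inE.
  - by rewrite inE; case: ifP.
  exists 2, 0%N, w => x hx; pose Phi (i : 'I_2) := if i == 0 then Fk else Gk.
  have hW i e : dv 1 (\sum_l meval x (mderiv l (Phi i)) * w l e - (i == e)%:R).
    apply: (@jacobian_congr _ _ _ u); last by apply: hw; rewrite inE.
    exact: congv_sym.
  pose h (y : 'I_2 -> O) := dshell pi chi kappa (j - a) (y 0) * trunc_char N (pi ^+ b * y 1).
  rewrite (eq_bigr (fun t : grid K 2 L =>
    h (fun i => meval (shiftv pi 0 x w (repv pi t)) (Phi i)))); last first.
    by move=> t _; rewrite shell_term_dilate.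
  rewrite (equidistribution hpi hW).
    pose h2 (i : 'I_2) (y : O) := if i == 0
      then dshell pi chi kappa (j - a) (meval x Fk + pi ^+ 1 * y)
      else trunc_char N (pi ^+ b * (meval x Gk + pi ^+ 1 * y)).
    rewrite (eq_bigr (fun t : grid K 2 L => \prod_i h2 i (repv pi t i))).
      rewrite sum_grid_prod big_ord_recl /= sum_dshell_coset ?mul0r //; lia.
    have e1 : lift ord0 ord0 = 1 :> 'I_2 by apply: val_inj.
    by move=> t _; rewrite big_ord_recl big_ord1 e1.
  move=> y y' hyy; rewrite /h; congr (_ * _).
    by apply: (dshell_congr hpi hchi); apply: dv_leq (hyy 0); lia.
  apply: trunc_char_congr; rewrite -mulrBr dvMl //; apply: dv_leq (hyy 1); lia.
(* only F vanishes modulo pi: translations by multiples of pi^(c + 1) do not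
   change the character of the unit G *)
have [|i|w hw] := nondegenerate_lift hpi hnd ha hb hu (I := [set 0 : 'I_2]).
- by apply/set0Pn; exists 0; rewrite inE.
- by rewrite inE; case: (i =P 0) => [_|_]; rewrite ?(negPf gu).
exists 1%N, c, (fun l _ => w l 0) => x hx.
have hW (i e : 'I_1) : dv 1 (\sum_l meval x (mderiv l Fk) * w l 0 - (i == e)%:R).
  rewrite !ord1 eqxx; apply: (@jacobian_congr _ _ _ u); first exact: congv_sym.
  by apply: (hw 0 0); rewrite inE.
have gx : meval x Gk \is a GRing.unit by rewrite unitE (dv1_meval _ hx).
pose h (y : 'I_1 -> O) := dshell pi chi kappa (j - a) (y 0).
rewrite (eq_bigr (fun t : grid K 1 L => trunc_char N (pi ^+ b * meval x Gk) *
    h (fun i => meval (shiftv pi c x (fun l _ => w l 0) (repv pi t)) Fk))); last first.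
  move=> t _; rewrite shell_term_dilate [LHS]mulrC; congr (_ * _).
  apply/esym/trunc_char_unit => //; apply: (meval_congr hpi) => l.
  by rewrite dv_sym /shiftv [X in X - _]addrC addrK dv_piX.
rewrite -mulr_sumr (equidistribution hpi (Phi := fun=> Fk) hW).
  pose h1 (_ : 'I_1) y := dshell pi chi kappa (j - a) (meval x Fk + pi ^+ c.+1 * y).
  rewrite (eq_bigr (fun t : grid K 1 L => \prod_i h1 i (repv pi t i))).
    rewrite sum_grid_prod big_ord1 sum_dshell_coset ?mulr0 //; lia.
  by move=> t _; rewrite big_ord1.
by move=> y y' hyy; apply: (dshell_congr hpi hchi); apply: dv_leq (hyy 0); lia.
Qed.

Definition in_class (x : 'I_n -> O) : bool :=
  [forall l, dv (k l).+1 (x l - pi ^+ k l * u l)].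

(** The class is stable under the translations of [local_cancellation], so the
sum over it is also the sum of the averages over translates, and these
vanish. *)
Lemma class_cancellation M : (forall l, (k l < M)%N) -> (j + N + c.+1 <= M)%N ->
  \sum_(t : grid K n M | in_class (repv pi t)) shell_term j N (repv pi t) = 0.
Proof.
move=> kM hM; have [d [m [W hW]]] := local_cancellation hM.
pose H x := if in_class x then shell_term j N x else 0.
rewrite big_mkcond /= -/(\sum_(t : grid K n M) H (repv pi t)).
have perH : periodic M H.
  move=> x y xy; rewrite /H (shell_term_periodic hM xy); congr (if _ then _ else _).
  apply/forallP/forallP => h l; have := h l; apply: dv_trans.
    by apply: dv_leq (kM l) _; rewrite dv_sym.
  exact: dv_leq (kM l) _.
set S := \sum_(t : _) _; pose w (t : grid K d M) l :=
   pi ^+ k l * (pi ^+ m.+1 * \sum_e W l e * repv pi t e).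
suff : \sum_(t : grid K d M) S = 0.
  move/eqP; rewrite sumr_const mulrn_eq0 => /orP[|/eqP //].
  by rewrite card_grid expn_eq0 /qcard -leqn0 leqNgt (cardD1 0).
rewrite (eq_bigr (fun t : grid K d M => \sum_(s : grid K n M) H (fun l => repv pi s l + w t l))).
  rewrite exchange_big /=; apply: big1 => s _; rewrite /H.
  have hcl t : in_class (fun l => repv pi s l + w t l) = in_class (repv pi s).
    apply: eq_forallb => l; apply: dv_eqr; rewrite opprB addrA subrK [X in X - _]addrC addrK.
    by rewrite /w mulrA -exprD; apply: dv_leq (dv_piX hpi _ _); lia.
  have [hs|hs] := boolP (in_class (repv pi s)); last first.
    by apply: big1 => t _; rewrite hcl (negPf hs).
  have hx l : exists x, repv pi s l = pi ^+ k l * x /\ dv 1 (x - u l).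
    have /(dvP hpi)[z hz] := forallP hs l; exists (u l + pi * z); split.
      by rewrite mulrDr mulrA -exprSr -hz addrC subrK.
    by rewrite [X in X - _]addrC addrK -[pi]expr1 dv_piX.
  have {}hx l := cid (hx l); pose x l := projT1 (hx l).
  rewrite -[RHS](hW x); last by move=> l; rewrite /x; case: (hx l) => y [].
  apply: eq_bigr => t _; rewrite hcl hs; congr shell_term; apply/funext => l.
  by rewrite /w /shiftv [RHS]mulrDr /x; case: (hx l) => y [/= <-].
move=> t _; by rewrite (sum_translate hpi _ perH).
Qed.

End Class.
End LocalCancellation.

(** * Exponential decay of the mean over the grid *)

Section TruncatedOrder.
Variables (R : realType) (K : localFieldType) (pi : valuation_ring K).
Hypothesis hpi : uniformizer pi.
Local Notation O := (valuation_ring K).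
Local Notation F := (@residue_field K).
Local Notation C := R[i].
Implicit Types (y : O) (M : nat).

(** The order of y as far as the first M digits of y determine it. *)
Definition trunc_ord M y : nat := if dv M y then M else ord y.

Definition lead_res M y : F := if dv M y then 0 else residue (ac pi (val y)).

Lemma trunc_ord_le M y : (trunc_ord M y <= M)%N.
Proof.
rewrite /trunc_ord; case: ifP => // /negbT; rewrite dvE negb_or -ltnNge => /andP[_ /ltnW //].
Qed.

Lemma trunc_ord_pi M y : trunc_ord M.+1 (pi * y) = (trunc_ord M y).+1.
Proof.
rewrite /trunc_ord dv_piM //; case: ifP => // /negbT; rewrite dvE negb_or => /andP[y0 _].
by rewrite ordM ?(pi_neq0 hpi) // (ord_pi hpi).
Qed.

Lemma lead_res_class M y e (u : O) : (e < M)%N -> u \is a GRing.unit ->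
  (trunc_ord M y == e) && (lead_res M y == residue u) = dv e.+1 (y - pi ^+ e * u).
Proof.
move=> eM hu; apply/andP/idP => [[]|h].
  rewrite /trunc_ord /lead_res; case: ifP => [_ /eqP eE|/negbT]; first by move: eM; rewrite eE ltnn.
  rewrite dvE negb_or => /andP[y0 _] /eqP oy hr.
  have [_ {1}->] := vdecomp hpi y0; rewrite oy -mulrBr -[e.+1]addn1 dv_piXM //.
  by rewrite dv1B.
have x0 : pi ^+ e * u != 0 by rewrite mulf_neq0 ?piX_neq0 ?unit_neq0.
have [||y0 oy hac] := @dv_ord_ac _ _ hpi e 0 (pi ^+ e * u) y x0.
- by rewrite ord_piXu.
- by rewrite addn1 dv_sym.
have ny : dv M y = false by rewrite dvE (negPf y0) oy leqNgt eM.
rewrite /trunc_ord /lead_res ny oy eqxx; split=> //.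
by move: hac; rewrite ac_piXu // dv1B eq_sym.
Qed.

Lemma lead_res_neq0 M y : (trunc_ord M y < M)%N -> lead_res M y != 0.
Proof.
rewrite /trunc_ord /lead_res; case: ifP => [|/negbT]; first by rewrite ltnn.
rewrite dvE negb_or => /andP[y0 _] _; rewrite -unit_residue.
by case: (vdecomp hpi y0).
Qed.

(** Up to the factor q^M this is the integral of rho^(ord y), a geometric series
of ratio rho / q.  The condition on B is what the induction on the number of
digits uses; q / (q - rho) satisfies it. *)
Lemma sum_trunc_ord (rho B : C) M : 0 <= rho -> 1 <= B ->
  (qcard K)%:R + rho * B <= (qcard K)%:R * B ->
  \sum_(s : M.-tuple F) rho ^+ trunc_ord M (rep pi s) <= (qcard K)%:R ^+ M * B.
Proof.
move=> rho0 B1 hB; elim: M => [|M IH].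
  rewrite (eq_bigr (fun=> 1)) => [|s _]; last by rewrite /trunc_ord dv0.
  by rewrite sumr_const card_tuple expn0 mulr1n mul1r.
rewrite (sum_tuple_cons _ (fun s => rho ^+ trunc_ord M.+1 (rep pi s))) (bigD1 0) //=.
rewrite (eq_bigr (fun s : M.-tuple F => rho * rho ^+ trunc_ord M (rep pi s))); last first.
  by move=> s _; rewrite lift_res0 add0r trunc_ord_pi exprS.
rewrite -mulr_sumr exprS -mulrA mulrCA.
apply: le_trans (ler_wpM2l _ hB); last by rewrite exprn_ge0.
rewrite mulrDr addrC mulrCA; apply: lerD; last exact: ler_wpM2l.
apply: (@le_trans _ _ (\sum_(a : F) \sum_(s : M.-tuple F) 1)); last first.
  by rewrite !sumr_const card_tuple -natrX [X in _ <= X]mulr_natr.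
rewrite [leRHS](bigD1 0) //=; apply: ler_wpDl; first by rewrite sumr_ge0.
apply: ler_sum => a a0; apply: ler_sum => s _.
have hu : rep pi (a :: s) \is a GRing.unit by rewrite unit_residue residue_rep.
by rewrite /trunc_ord -[lift_res a + _]/(rep pi (a :: s)) dvE (negPf (unit_neq0 hu)) ord_unit.
Qed.

End TruncatedOrder.

Section Estimate.
Variables (R : realType) (K : localFieldType) (pi : valuation_ring K).
Hypothesis hpi : uniformizer pi.
Local Notation O := (valuation_ring K).
Local Notation F := (@residue_field K).
Local Notation C := R[i].

(** The integral over O^n of a function that is constant on the classes modulo
pi^M. *)
Definition grid_mean n M (h : ('I_n -> O) -> C) : C :=
  ((qcard K)%:R ^+ (M * n))^-1 * \sum_(t : grid K n M) h (repv pi t).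

Variables (n : nat) (f g : mpoly n O) (chi chi' : O -> C) (c : nat) (kappa Y : C).
Hypotheses (hchi : has_conductor chi c) (hchi' : has_conductor chi' c).
Hypothesis hnd : newton_nondegenerate R f g.
Hypothesis hk : cancelling chi kappa.
Hypothesis hkappa : `|kappa| <= 1.
Hypothesis hY : `|Y| <= 1.
Hypotheses (f0 : f != 0) (g0 : g != 0).
Variables (r rho B : C).
Hypotheses (r0 : 0 < r) (r1 : r <= 1) (rho1 : 1 <= rho) (B1 : 1 <= B).
Hypothesis hB : (qcard K)%:R + rho * B <= (qcard K)%:R * B.
Hypothesis hr : forall k a, is_dmin k f a -> 1 <= r ^+ a * rho ^+ (\sum_l k l).

Local Notation T := (shell_term pi f g chi chi' kappa Y).

Definition class_of M (t : grid K n M) : {ffun 'I_n -> 'I_M.+1 * F} :=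
  [ffun l => (inord (trunc_ord M (repv pi t l)), lead_res pi M (repv pi t l))].

(** A class either cancels or satisfies j <= a + c + 1, where
a = d(k, Gamma(f)).  In the latter case the relation between r and rho makes
the weight r^(j - c - 1) rho^(ord x) at least 1. *)
Lemma class_sum_bound j N M p : (j + N + c.+1 <= M)%N -> 1 <= r ^+ j * rho ^+ M ->
  `|\sum_(t : grid K n M | class_of t == p) T j N (repv pi t)| <=
  \sum_(t : grid K n M | class_of t == p)
     2 * (r ^+ (j - c.+1) * rho ^+ (\sum_l trunc_ord M (repv pi t l))).
Proof.
move=> hM hjM; have rho0 : 0 <= rho by rewrite (le_trans ler01).
have rle e e' : (e <= e')%N -> r ^+ e' <= r ^+ e by move=> he; apply: ler_wiXn2l => //; exact: ltW.
have ole t l : class_of t = p -> trunc_ord M (repv pi t l) = (p l).1 :> nat.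
  by move=> <-; rewrite ffunE /= inordK // ltnS trunc_ord_le.
have triv : (forall t, class_of t = p ->
    1 <= r ^+ (j - c.+1) * rho ^+ (\sum_l trunc_ord M (repv pi t l))) ->
  `|\sum_(t : grid K n M | class_of t == p) T j N (repv pi t)| <=
  \sum_(t : grid K n M | class_of t == p)
     2 * (r ^+ (j - c.+1) * rho ^+ (\sum_l trunc_ord M (repv pi t l))).
  move=> h; apply: (le_trans (ler_norm_sum _ _ _)); apply: ler_sum => t /eqP tp.
  apply: (le_trans (shell_term_norm hpi f g hchi hchi' hkappa hY _ _ _)).
  by rewrite -[leLHS]mulr1 ler_pM2l // h.
(* a coordinate that vanishes modulo pi^M makes the weight large by itself *)
have [/existsP[l /eqP pl]|] := boolP [exists l, (p l).1 == M :> nat].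
  apply: triv => t tp; apply: (le_trans hjM); apply: ler_pM => //.
  - by rewrite exprn_ge0 // ltW.
  - by rewrite exprn_ge0.
  - by apply: rle; apply: leq_subr.
  by apply: ler_weXn2l => //; rewrite (bigD1 l) //= (ole t) // pl leq_addr.
rewrite negb_exists => /forallP pM.
have {}pM l : ((p l).1 < M)%N.
  by rewrite ltn_neqAle pM -ltnS ltn_ord.
have [t0 /eqP t0p|none] := pickP (fun t : grid K n M => class_of t == p); last first.
  by rewrite !big_pred0 // normr0.
pose k l : nat := (p l).1; pose u l := lift_res (p l).2.
have hu l : u l \is a GRing.unit.
  rewrite unit_residue lift_resK -t0p ffunE /= lead_res_neq0 //.
  by rewrite ole.
have [a ha] := is_dmin_ex k f0; have [b hb] := is_dmin_ex k g0.
have [haj|haj] := ltnP (a + c.+1) j.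
  rewrite (eq_bigl (fun t => in_class pi k u (repv pi t))) => [|t].
    rewrite (class_cancellation hpi hchi hchi' hnd hk hkappa hY ha hb hu haj) //.
    rewrite normr0 sumr_ge0 // => t _.
    by rewrite !mulr_ge0 // exprn_ge0 // ltW.
  apply/eqP/forallP => [tp l|h].
    rewrite -(@lead_res_class _ _ hpi M) ?pM // ole // eqxx /=.
    by rewrite lift_resK -tp ffunE.
  apply/ffunP => l; have := h l; rewrite -(@lead_res_class _ _ hpi M) ?pM //.
  rewrite lift_resK => /andP[/eqP e1 /eqP e2]; rewrite ffunE e1 e2 /k.
  by rewrite inord_val; case: (p l).
apply: triv => t tp; apply: (le_trans (hr ha)).
have -> : (\sum_l trunc_ord M (repv pi t l) = \sum_l k l)%N.
  by apply: eq_bigr => l _; rewrite (ole t l tp).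
by apply: ler_wpM2r; [rewrite exprn_ge0|apply: rle; rewrite leq_subLR addnC].
Qed.

(** The weights of [class_sum_bound] form a product over the coordinates, so
their sum is a power of the sum in [sum_trunc_ord]. *)
Lemma grid_mean_shell_term j N M : (j + N + c.+1 <= M)%N -> 1 <= r ^+ j * rho ^+ M ->
  `|grid_mean M (T j N)| <= 2 * r ^+ (j - c.+1) * B ^+ n.
Proof.
move=> hM hjM; rewrite /grid_mean normrM normfV normrX normr_nat.
have q0 : (0 : C) < (qcard K)%:R ^+ (M * n).
  by rewrite exprn_gt0 // ltr0n /qcard (cardD1 0).
rewrite mulrC ler_pdivrMr // (partition_big (@class_of M) predT) //=.
apply: (le_trans (ler_norm_sum _ _ _)).
apply: (le_trans (ler_sum _ (fun p _ => class_sum_bound p hM hjM))).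
pose w (t : grid K n M) := 2 * (r ^+ (j - c.+1) * rho ^+ (\sum_l trunc_ord M (repv pi t l))).
have <- : \sum_(t : grid K n M) w t = \sum_p \sum_(t | class_of t == p) w t.
  by rewrite (partition_big (@class_of M) predT).
rewrite -!mulr_sumr -!mulrA ler_pM2l // ler_wpM2l ?exprn_ge0 ?(ltW r0) //.
under eq_bigr do rewrite expr_sum.
rewrite (sum_grid_prod pi M (fun (_ : 'I_n) y => rho ^+ trunc_ord M y)).
have rho0 : 0 <= rho by rewrite (le_trans ler01).
rewrite prodr_const card_ord exprM -exprMn mulrC lerXn2r ?nnegrE //.
- by rewrite sumr_ge0 // => s _; rewrite exprn_ge0.
- by rewrite mulr_ge0 ?exprn_ge0 // (le_trans ler01).
- exact: sum_trunc_ord.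
Qed.
End Estimate.

(** * Haar integrals as limits of means over grids *)

Section HaarIntegral.
Variables (R : realType) (K : localFieldType) (pi : valuation_ring K).
Hypothesis hpi : uniformizer pi.
Local Notation O := (valuation_ring K).
Variables (n : nat) (mu : {measure set (Kn K n) -> \bar R}).
Hypothesis hmu : is_haar mu.

Local Notation On := (@On K n).

(** On O^n the default value is never used. *)
Definition coords (x : 'rV[K]_n) : 'I_n -> O := fun l => insubd 0 (x 0 l).

Lemma val_coords x l : On x -> val (coords x l) = x 0 l.
Proof. by move=> xO; rewrite val_insubd [_ \in _]xO. Qed.

(** The coset x + pi^M O^n. *)
Definition poly_ball M (x : 'rV[K]_n) : set (Kn K n) :=
  [set y : 'rV[K]_n | forall l, vge M%:Z (y 0 l - x 0 l)].

Lemma vgeD (m : int) (x y : K) : vge m x -> vge m y -> vge m (x + y).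
Proof.
rewrite /vge; have [->|x0] := eqVneq x 0; first by rewrite add0r.
have [->|y0] := eqVneq y 0; first by rewrite addr0 (negPf x0).
rewrite !orFb => hx hy; have [//|xy0] := eqVneq (x + y) 0.
by rewrite orFb (le_trans _ (nuD _ _ x0 y0 xy0)) // le_min hx hy.
Qed.

Lemma poly_ball_open M x : Kn_open (poly_ball M x).
Proof.
move=> y yx; exists M%:Z => z zy l.
by have := vgeD (zy l) (yx l); rewrite addrA subrK.
Qed.

Lemma measurable_open (U : set (affine_space K n)) :
  Kn_open U -> measurable (U : set (Kn K n)).
Proof. by move=> hU; apply: sub_sigma_algebra. Qed.

Lemma measurable_poly_ball M x : measurable (poly_ball M x).
Proof. exact: measurable_open (@poly_ball_open M x). Qed.

Lemma On_ball : On = poly_ball 0 0.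
Proof. by apply/seteqP; split=> x hx l; have := hx l; rewrite mxE subr0. Qed.

Lemma measurable_On : measurable On.
Proof. rewrite On_ball; exact: measurable_poly_ball. Qed.

Definition grid_point M (t : grid K n M) : 'rV[K]_n := \row_l val (repv pi t l).

Lemma grid_ballP M (t : grid K n M) (x : 'rV[K]_n) :
  poly_ball M (grid_point t) x <-> On x /\ congv M (coords x) (repv pi t).
Proof.
split=> [hx|[xO h] l]; last first.
  by have := h l; rewrite /dv rmorphB /= val_coords // mxE.
have xO : On x.
  move=> l; have := hx l; rewrite mxE => h.
  rewrite -[x 0 l](subrK (val (repv pi t l))); apply: vgeD; last exact: (valP (repv pi t l)).
  by move: h; rewrite /vge => /orP[->//|h]; rewrite (le_trans _ h) ?orbT.
split=> // l; have := hx l.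
by rewrite /dv rmorphB /= val_coords // mxE.
Qed.

Lemma On_bigsetU M : On = \big[setU/set0]_(t <- index_enum (grid K n M)) poly_ball M (grid_point t).
Proof.
rewrite -bigcup_seq; apply/seteqP; split=> [x xO|x [t _ /grid_ballP[]//]].
exists (digitsv hpi M (coords x)); first by rewrite /= mem_index_enum.
by apply/grid_ballP; split=> //; apply: digitsvP.
Qed.

Lemma trivIset_grid M : trivIset [set` index_enum (grid K n M)] (fun t => poly_ball M (grid_point t)).
Proof.
move=> s t _ _ [x [/grid_ballP[_ h1] /grid_ballP[_ h2]]]; apply: (repv_inj hpi).
exact: congv_trans (congv_sym h1) h2.
Qed.

Lemma measure_translate M x : mu (poly_ball M x) = mu (poly_ball M 0).
Proof.
case: hmu => h _; rewrite -(h x _ (measurable_poly_ball M 0)); congr (mu _).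
apply/seteqP; split=> y.
  move=> hy; exists (y - x); last by rewrite addrC subrK.
  by move=> l; have := hy l; rewrite !mxE subr0.
by case=> z hz <- l; have := hz l; rewrite !mxE subr0 [X in X - _]addrC addrK.
Qed.

Lemma measure_On : mu On = 1%E. Proof. by case: hmu. Qed.

Lemma measure_ball_lt M x : (mu (poly_ball M x) < +oo)%E.
Proof.
rewrite measure_translate; apply: (@le_lt_trans _ _ (mu On)); last by rewrite measure_On ltry.
apply: le_measure; rewrite ?inE; [exact: measurable_poly_ball|exact: measurable_On|].
move=> y hy l; have := hy l; rewrite mxE subr0 /vge => /orP[->//|h].
by rewrite (le_trans _ h) ?orbT.
Qed.

(** The q^(M n) cosets that make up O^n have equal measures by translation
invariance. *)
Lemma measure_ball M x : fine (mu (poly_ball M x)) = ((qcard K)%:R ^+ (M * n))^-1.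
Proof.
have q0 : (qcard K)%:R ^+ (M * n) != 0 :> R.
  by rewrite expf_neq0 // pnatr_eq0 -lt0n /qcard (cardD1 0).
apply: (mulfI q0); rewrite mulfV //.
have int1 (D : set (Kn K n)) : measurable D -> (\int[mu]_(x in D) (cst (1 : R) x)%:E = mu D)%E.
  by move=> mD; rewrite -[LHS]/(\int[mu]_(x in D) cst 1%E x)%E integral_cst // mul1e.
have h1 : (\int[mu]_(x in On) (cst (1 : R) x)%:E = 1)%E.
  by rewrite int1 ?measure_On //; exact: measurable_On.
have := h1; rewrite {1}(On_bigsetU M).
rewrite integral_bigsetU_EFin; first last.
- by rewrite -(On_bigsetU M); apply/measurable_EFinP; exact: measurable_cst.
- exact: trivIset_grid.
- exact: index_enum_uniq.
- by move=> t; apply: measurable_poly_ball.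
move=> /(congr1 fine); rewrite -sum_fine /=; last first.
  move=> t _; rewrite int1; last exact: measurable_poly_ball.
  by rewrite ge0_fin_numE // measure_ball_lt.
under eq_bigr do rewrite (int1 _ (measurable_poly_ball _ _)) measure_translate.
rewrite sumr_const card_grid => h2.
by rewrite measure_translate -natrX mulr_natl.
Qed.

Definition ucont (h : ('I_n -> O) -> R) := forall e : R, 0 < e ->
  exists N, forall x y, congv N x y -> `|h x - h y| <= e.

Lemma ucont_measurable h : ucont h -> measurable_fun On (h \o coords).
Proof.
move=> hu mO; apply: (measurability _ (RGenOInfty.measurableE R)) => //.
move=> /= _ [_ [a ->] <-]; apply: measurable_open => x [xO].
rewrite /= in_itv /= andbT => hx.
have e0 : 0 < (h (coords x) - a) / 2 by rewrite divr_gt0 // subr_gt0.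
have [N hN] := hu _ e0; exists N%:Z => y hy.
have yO : On y.
  move=> l; rewrite -[y 0 l](subrK (x 0 l)); apply: vgeD; last exact: xO.
  by move: (hy l); rewrite /vge => /orP[->//|h']; rewrite (le_trans _ h') ?orbT.
split=> //=; rewrite in_itv /= andbT.
have /hN : congv N (coords x) (coords y).
  by move=> l; rewrite dv_sym /dv rmorphB /= !val_coords // hy.
by rewrite ler_norml => /andP[_]; lra.
Qed.

Lemma ucont_bounded h : ucont h -> exists B, forall x, `|h x| <= B.
Proof.
move=> /(_ 1 ltr01)[N hN]; exists (1 + \sum_(t : grid K n N) `|h (repv pi t)|) => x.
have := hN _ _ (digitsvP hpi N x); set t := digitsv _ _ _ => h1.
have : `|h (repv pi t)| <= \sum_(t : grid K n N) `|h (repv pi t)|.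
  by rewrite (bigD1 t) //= lerDl sumr_ge0.
have := ler_normD (h x - h (repv pi t)) (h (repv pi t)); rewrite subrK; lra.
Qed.

Lemma ucont_integrable h : ucont h -> mu.-integrable On (EFin \o (h \o coords)).
Proof.
move=> hu; apply: measurable_bounded_integrable => //.
- exact: measurable_On.
- by rewrite measure_On ltry.
- exact: ucont_measurable.
have [B hB] := ucont_bounded hu; exists B; split=> [|M BM x _ /=].
  by apply: ger0_real; apply: le_trans (hB (fun=> 0)).
by apply: le_trans (hB _) _; exact: ltW.
Qed.

(** On each coset the function stays within e of its value at the
representative. *)
Lemma Rintegral_grid_mean h N e M : ucont h ->
  (forall x y, congv N x y -> `|h x - h y| <= e) -> (N <= M)%N ->
  `| \int[mu]_(x in On) h (coords x) -
     ((qcard K)%:R ^+ (M * n))^-1 * \sum_(t : grid K n M) h (repv pi t) | <= e.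
Proof.
move=> hu hN NM; set v := (_ ^+ _)^-1.
have v0 : 0 <= v by rewrite invr_ge0 exprn_ge0.
have hint := ucont_integrable hu.
have hintb (t : grid K n M) : mu.-integrable (poly_ball M (grid_point t)) (EFin \o (h \o coords)).
  apply: integrableS hint => //; [exact: measurable_On|exact: measurable_poly_ball|].
  by move=> x /grid_ballP[].
have -> : \int[mu]_(x in On) h (coords x) =
    \sum_(t : grid K n M) \int[mu]_(x in poly_ball M (grid_point t)) h (coords x).
  rewrite /Rintegral {1}(On_bigsetU M) integral_bigsetU_EFin; first last.
  - rewrite -(On_bigsetU M); apply/measurable_EFinP; exact: ucont_measurable.
  - exact: trivIset_grid.
  - exact: index_enum_uniq.
  - by move=> t; apply: measurable_poly_ball.
  rewrite -sum_fine // => t _.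
  exact: (integrable_fin_num (measurable_poly_ball _ _) (hintb t)).
rewrite mulr_sumr -sumrB; apply: (le_trans (ler_norm_sum _ _ _)).
have -> : e = \sum_(t : grid K n M) e * v.
  rewrite sumr_const card_grid -[RHS]mulr_natl mulrCA natrX divff ?mulr1 //.
  by rewrite expf_neq0 // pnatr_eq0 -lt0n /qcard (cardD1 0).
apply: ler_sum => t _.
have icst r : mu.-integrable (poly_ball M (grid_point t)) (EFin \o cst r).
  apply: measurable_bounded_integrable => //; [exact: measurable_poly_ball|exact: measure_ball_lt|].
  by exists `|r|; split=> [|b rb x _ /=]; [exact: num_real|exact: ltW].
have hh x : poly_ball M (grid_point t) x ->
    h (repv pi t) - e <= h (coords x) <= h (repv pi t) + e.
  move=> /grid_ballP[_ hx]; have := hN _ _ (congv_leq NM hx).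
  by rewrite ler_norml => /andP[]; lra.
have ub : \int[mu]_(x in poly_ball M (grid_point t)) h (coords x) <= (h (repv pi t) + e) * v.
  rewrite /v -(measure_ball M (grid_point t)) -(Rintegral_cst mu (measurable_poly_ball _ _)).
  apply: le_Rintegral => //; [exact: measurable_poly_ball|exact: icst|].
  by move=> x /hh /andP[].
have lb : (h (repv pi t) - e) * v <= \int[mu]_(x in poly_ball M (grid_point t)) h (coords x).
  rewrite /v -(measure_ball M (grid_point t)) -(Rintegral_cst mu (measurable_poly_ball _ _)).
  apply: le_Rintegral => //; [exact: measurable_poly_ball|exact: icst|].
  by move=> x /hh /andP[].
rewrite ler_norml; apply/andP; split; [move: lb|move: ub]; rewrite !(mulrDl, mulrBl, mulNr) [v * _]mulrC; lra.
Qed.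

End HaarIntegral.

(** * Complex integrals and the power series of the zeta function *)

Section ComplexEstimates.
Variable R : realType.
Local Notation C := R[i].
Implicit Types (z w : C) (e : R).

Lemma normE z : `|z| = (complex.Re `|z|)%:C.
Proof. by rewrite normc_def. Qed.

Lemma lerC (x y : R) : (x%:C <= y%:C :> C) = (x <= y).
Proof. by rewrite lecE /= eqxx. Qed.

Lemma ltrC (x y : R) : (x%:C < y%:C :> C) = (x < y).
Proof. by rewrite ltcE /= eqxx. Qed.

Lemma normCR (x : R) : `|x%:C| = `|x|%:C :> C.
Proof. by rewrite normc_def /= expr0n addr0 sqrtr_sqr. Qed.

Lemma norm_le_eps z (B : C) : (forall e, 0 < e -> `|z| <= B + e%:C) -> `|z| <= B.
Proof.
move=> h; have := h 1 ltr01; rewrite normE; case: B h => b b' h.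
rewrite lecE /= addr0 => /andP[/eqP b0 _]; rewrite b0 in h *.
rewrite lecE /= eqxx; apply/ler_addgt0Pr => e e0.
by have := h e e0; rewrite normE lecE /= addr0 eqxx.
Qed.

Lemma eq0_eps z : (forall e, 0 < e -> `|z| <= e%:C) -> z = 0.
Proof.
move=> h; apply/eqP; rewrite -normr_le0; apply: norm_le_eps => e e0.
by rewrite add0r h.
Qed.

Lemma geometric_small (x e : R) : 0 <= x -> x < 1 -> 0 < e -> exists N, x ^+ N <= e.
Proof.
move=> x0 x1 e0; have : `|x| < 1 by rewrite ger0_norm.
move=> /cvg_expr/cvgrPdist_le/(_ e e0)[N _ hN]; exists N.
by have := hN N (leqnn N); rewrite /= sub0r normrN ger0_norm // exprn_ge0.
Qed.

Lemma geometric_smallC z e : `|z| < 1 -> 0 < e -> exists N, `|z| ^+ N <= e%:C.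
Proof.
rewrite normE -[1]/(1%:C) ltrC => z1 e0.
have z0 : 0 <= complex.Re `|z| by rewrite -lerC -normE normr_ge0.
have [N hN] := geometric_small z0 z1 e0; exists N.
by rewrite -rmorphXn lerC.
Qed.

End ComplexEstimates.

Section ComplexHaarIntegral.
Variables (R : realType) (K : localFieldType) (pi : valuation_ring K).
Hypothesis hpi : uniformizer pi.
Local Notation O := (valuation_ring K).
Local Notation C := R[i].
Variables (n : nat) (mu : {measure set (Kn K n) -> \bar R}).
Hypothesis hmu : is_haar mu.
Implicit Types h : ('I_n -> O) -> C.

Local Notation On := (@On K n).
Local Notation mean := (@grid_mean R K pi n).

Definition cucont h := forall e : R, 0 < e ->
  exists N, forall x y, congv N x y -> `|h x - h y| <= e%:C.

Definition cint h : C := cintegral mu On (fun x => h (coords x)).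

Lemma grid_meanD M h1 h2 : mean M (fun x => h1 x + h2 x) = mean M h1 + mean M h2.
Proof. by rewrite /grid_mean big_split mulrDr. Qed.

Lemma grid_meanZ M a h : mean M (fun x => a * h x) = a * mean M h.
Proof. by rewrite /grid_mean -mulr_sumr mulrCA. Qed.

Lemma grid_mean_bound M h B : (forall x, `|h x| <= B) -> `|mean M h| <= B.
Proof.
move=> hB; rewrite /grid_mean normrM normfV normrX normr_nat.
rewrite mulrC ler_pdivrMr; last by rewrite exprn_gt0 // ltr0n /qcard (cardD1 0).
apply: (le_trans (ler_norm_sum _ _ _)); apply: (le_trans (ler_sum _ (fun t _ => hB _))).
by rewrite sumr_const card_grid -[leLHS]mulr_natr natrX.
Qed.

Lemma grid_meanB M h1 h2 : mean M (fun x => h1 x - h2 x) = mean M h1 - mean M h2.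
Proof. by rewrite /grid_mean sumrB mulrBr. Qed.

Lemma cint_grid_mean h : cucont h -> forall e, 0 < e ->
  exists N0, forall M, (N0 <= M)%N -> `|cint h - mean M h| <= e%:C.
Proof.
move=> hu e e0; have e20 : 0 < e / 2 by rewrite divr_gt0.
have hRe (z : C) : `|complex.Re z| <= complex.Re `|z|.
  by have := normc_ge_Re z; rewrite normE lerC.
have hIm (z : C) : `|complex.Im z| <= complex.Re `|z|.
  have -> : `|z| = `|'i * z| by rewrite normrM normCi mul1r.
  have -> : `|complex.Im z| = `|complex.Re ('i * z)|.
    by case: z => a b /=; rewrite mul0r mul1r sub0r normrN.
  exact: hRe.
have uRe : ucont (fun x => complex.Re (h x)).
  move=> d d0; have [N hN] := hu d d0; exists N => x y /hN.
  by rewrite -raddfB normE lerC; exact: (le_trans (hRe _)).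
have uIm : ucont (fun x => complex.Im (h x)).
  move=> d d0; have [N hN] := hu d d0; exists N => x y /hN.
  by rewrite -raddfB normE lerC; exact: (le_trans (hIm _)).
have [N hN] := hu _ e20; exists N => M NM.
have hNR x y : congv N x y -> `|complex.Re (h x) - complex.Re (h y)| <= e / 2.
  by move=> /hN; rewrite -raddfB normE lerC; exact: (le_trans (hRe _)).
have hNI x y : congv N x y -> `|complex.Im (h x) - complex.Im (h y)| <= e / 2.
  by move=> /hN; rewrite -raddfB normE lerC; exact: (le_trans (hIm _)).
have := Rintegral_grid_mean hpi hmu uRe hNR NM; have := Rintegral_grid_mean hpi hmu uIm hNI NM.
rewrite /cint /cintegral; set a := (\int[mu]_(x in On) _); set b := (\int[mu]_(x in On) _).
set v := _ ^- _ => ha hb.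
have vE : ((qcard K)%:R ^+ (M * n))^-1 = v%:C :> C.
  by rewrite /v fmorphV rmorphXn rmorph_nat.
have -> : mean M h = (v * \sum_(t : grid K n M) complex.Re (h (repv pi t))) +i*
                    (v * \sum_(t : grid K n M) complex.Im (h (repv pi t))).
  rewrite /grid_mean vE -!raddf_sum; case: (\sum_(t : _) _) => s1 s2.
  by apply/eqP; rewrite eq_complex /= !mul0r subr0 addr0 !eqxx.
set sa := v * _ in hb *; set sb := v * _ in ha *.
have -> : (b +i* a) - (sa +i* sb) = (b - sa)%:C + 'i * (a - sb)%:C.
  by apply/eqP; rewrite eq_complex /= !mul0r !mul1r !sub0r ?oppr0 ?addr0 ?add0r !eqxx.
apply: (le_trans (ler_normD _ _)); rewrite normrM normCi mul1r !normCR -rmorphD lerC.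
by rewrite [leRHS](splitr e); apply: lerD.
Qed.

Lemma cint_uniq h A : cucont h -> (forall e : R, 0 < e ->
  exists N0, forall M, (N0 <= M)%N -> `|A - mean M h| <= e%:C) -> cint h = A.
Proof.
move=> hu hA; apply/eqP; rewrite -subr_eq0; apply/eqP/eq0_eps => e e0.
have e20 : 0 < e / 2 by rewrite divr_gt0.
have [N1 h1] := cint_grid_mean hu e20; have [N2 h2] := hA _ e20.
have hh := h1 _ (leq_maxl N1 N2); have {}h2 := h2 _ (leq_maxr N1 N2).
rewrite (_ : cint h - A = (cint h - mean (maxn N1 N2) h) - (A - mean (maxn N1 N2) h)); last by ring.
apply: (le_trans (ler_normB _ _)); rewrite (splitr e) rmorphD; exact: lerD.
Qed.

Lemma cucontD h1 h2 : cucont h1 -> cucont h2 -> cucont (fun x => h1 x + h2 x).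
Proof.
move=> u1 u2 e e0; have e20 : 0 < e / 2 by rewrite divr_gt0.
have [N1 H1] := u1 _ e20; have [N2 H2] := u2 _ e20; exists (maxn N1 N2) => x y xy.
rewrite opprD addrACA; apply: (le_trans (ler_normD _ _)).
rewrite (splitr e) rmorphD; apply: lerD.
  by apply: H1; apply: congv_leq xy; apply: leq_maxl.
by apply: H2; apply: congv_leq xy; apply: leq_maxr.
Qed.

Lemma cucontM h1 h2 : (forall x, `|h1 x| <= 2) -> (forall x, `|h2 x| <= 2) ->
  cucont h1 -> cucont h2 -> cucont (fun x => h1 x * h2 x).
Proof.
move=> b1 b2 u1 u2 e e0; have e20 : 0 < e / 2 / 2 by rewrite !divr_gt0.
have [N1 H1] := u1 _ e20; have [N2 H2] := u2 _ e20; exists (maxn N1 N2) => x y xy.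
rewrite (_ : h1 x * h2 x - h1 y * h2 y = (h1 x - h1 y) * h2 x + h1 y * (h2 x - h2 y)); last by ring.
have eE : e%:C = (e / 2 / 2)%:C * 2 + 2 * (e / 2 / 2)%:C.
  rewrite mulrC -mulrDr -rmorphD -splitr mulrDl mul1r -rmorphD -splitr //.
apply: (le_trans (ler_normD _ _)); rewrite eE !normrM; apply: lerD; apply: ler_pM => //.
  by apply: H1; apply: congv_leq xy; apply: leq_maxl.
by apply: H2; apply: congv_leq xy; apply: leq_maxr.
Qed.

Lemma cucont_periodic N h : periodic N h -> cucont h.
Proof.
move=> ph e e0; exists N => x y /ph ->; rewrite subrr normr0.
by rewrite -[0]/(0%:C) lerC ltW.
Qed.

Lemma cucontZ a h : cucont h -> cucont (fun x => a * h x).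
Proof.
move=> hu e e0; have a0 : 0 <= complex.Re `|a| by rewrite -lerC -normE normr_ge0.
have a1 : 0 < complex.Re `|a| + 1 by rewrite ltr_wpDl.
have [N hN] := hu _ (divr_gt0 e0 a1); exists N => x y /hN hxy.
rewrite -mulrBr normrM; apply: (@le_trans _ _ ((complex.Re `|a| + 1)%:C * (e / (complex.Re `|a| + 1))%:C)).
  by apply: ler_pM => //; rewrite [X in X <= _]normE lerC lerDl.
by rewrite -rmorphM mulrC divfK ?gt_eqF.
Qed.

Lemma cintD h1 h2 : cucont h1 -> cucont h2 ->
  cint (fun x => h1 x + h2 x) = cint h1 + cint h2.
Proof.
move=> u1 u2; apply: cint_uniq => [|e e0]; first exact: cucontD.
have e20 : 0 < e / 2 by rewrite divr_gt0.
have [N1 H1] := cint_grid_mean u1 e20; have [N2 H2] := cint_grid_mean u2 e20.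
exists (maxn N1 N2) => M; rewrite geq_max => /andP[/H1 h1' /H2 h2'].
rewrite grid_meanD opprD addrACA; apply: (le_trans (ler_normD _ _)).
rewrite (splitr e) rmorphD; exact: lerD.
Qed.

Lemma cintZ a h : cucont h -> cint (fun x => a * h x) = a * cint h.
Proof.
move=> hu; apply: cint_uniq => [|e e0]; first exact: cucontZ.
have a0 : 0 <= complex.Re `|a| by rewrite -lerC -normE normr_ge0.
have a1 : 0 < complex.Re `|a| + 1 by rewrite ltr_wpDl.
have [N1 H1] := cint_grid_mean hu (divr_gt0 e0 a1); exists N1 => M /H1 h1.
rewrite grid_meanZ -mulrBr normrM; apply: (@le_trans _ _ ((complex.Re `|a| + 1)%:C * (e / (complex.Re `|a| + 1))%:C)).
  by apply: ler_pM => //; rewrite [X in X <= _]normE lerC lerDl.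
by rewrite -rmorphM mulrC divfK ?gt_eqF.
Qed.

(** Bounds pass from the means to the integral.  Linearity of the integral is
proved in the same way, from the linearity of the means. *)
Lemma cint_le h (B : C) M1 : cucont h ->
  (forall M, (M1 <= M)%N -> `|mean M h| <= B) -> `|cint h| <= B.
Proof.
move=> hu hB; apply: norm_le_eps => e e0; have [N1 H1] := cint_grid_mean hu e0.
have h1 := H1 _ (leq_maxl N1 M1); have h2 := hB _ (leq_maxr N1 M1).
rewrite -(subrK (mean (maxn N1 M1) h) (cint h)) addrC.
by apply: (le_trans (ler_normD _ _)); apply: lerD.
Qed.

Lemma cint_bound h (B : C) : cucont h -> (forall x, `|h x| <= B) -> `|cint h| <= B.
Proof. by move=> hu hB; apply: (@cint_le _ _ 0%N) => // M _; apply: grid_mean_bound. Qed.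

Lemma cucont_sum N (H : nat -> ('I_n -> O) -> C) : (forall j, cucont (H j)) ->
  cucont (fun x => \sum_(j < N) H j x) /\
  cint (fun x => \sum_(j < N) H j x) = \sum_(j < N) cint (H j).
Proof.
move=> hu; elim: N => [|N [IH1 IH2]].
  have c0 : cucont (fun x => \sum_(j < 0) H j x).
    by apply: (@cucont_periodic 0) => x y _; rewrite !big_ord0.
  split=> //; rewrite big_ord0; apply: cint_uniq => // e e0; exists 0%N => M _.
  rewrite (_ : mean M _ = 0) ?subrr ?normr0 -?[0]/(0%:C) ?lerC ?ltW //.
  by rewrite /grid_mean big1 ?mulr0 // => t _; rewrite big_ord0.
have E : (fun x => \sum_(j < N.+1) H j x) = (fun x => \sum_(j < N) H j x + H N x).
  by apply/funext => x; rewrite big_ord_recr.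
rewrite E; split; first exact: cucontD.
by rewrite cintD // IH2 big_ord_recr.
Qed.

End ComplexHaarIntegral.

Section Coefficients.
Variables (R : realType) (K : localFieldType) (pi : valuation_ring K).
Hypothesis hpi : uniformizer pi.
Local Notation O := (valuation_ring K).
Local Notation C := R[i].

(** The function chi(ac y) |y|^s in terms of X = q^-s. *)
Definition power_char (chi : O -> C) (X : C) (y : O) : C :=
  if y == 0 then 0 else X ^+ ord y * chi (ac pi (val y)).

Section PowerChar.
Variables (chi : O -> C) (c : nat) (X : C).
Hypothesis hchi : has_conductor chi c.
Hypothesis hX : `|X| < 1.

Lemma power_char_norm y : `|power_char chi X y| <= 1.
Proof.
rewrite /power_char; case: eqVneq => [_|y0]; first by rewrite normr0 ler01.
case: hchi => _ hn _; rewrite normrM normrX hn; last by case: (vdecomp hpi y0).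
by rewrite mulr1 exprn_ile1 // ltW.
Qed.

Lemma power_char_trunc N y : `|power_char chi X y - trunc_char pi chi X N y| <= `|X| ^+ N.
Proof.
rewrite trunc_charE /power_char; case: eqVneq => [_|y0 /=].
  by rewrite subrr normr0 exprn_ge0.
case: ltnP => yN; first by rewrite subrr normr0 exprn_ge0.
case: hchi => _ hn _; rewrite subr0 normrM normrX hn; last by case: (vdecomp hpi y0).
by rewrite mulr1; apply: ler_wiXn2l => //; exact: ltW.
Qed.

Lemma power_char_cucont n (p : mpoly n O) : cucont (fun x => power_char chi X (meval x p)).
Proof.
move=> e e0; have e20 : 0 < e / 2 by rewrite divr_gt0.
have [N hN] := geometric_smallC hX e20; exists (N + c.+1)%N => x y xy.
have E : trunc_char pi chi X N (meval x p) = trunc_char pi chi X N (meval y p).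
  by apply: (trunc_char_congr hpi X hchi); apply: (meval_congr hpi).
set a := power_char _ _ _; set b := power_char _ _ _.
rewrite (_ : a - b = (a - trunc_char pi chi X N (meval x p)) - (b - trunc_char pi chi X N (meval y p))); last first.
  by rewrite E; ring.
apply: (le_trans (ler_normB _ _)); rewrite (splitr e) rmorphD.
by apply: lerD; apply: le_trans hN; exact: power_char_trunc.
Qed.

End PowerChar.

Variables (n : nat) (mu : {measure set (Kn K n) -> \bar R}).
Hypothesis hmu : is_haar mu.
Variables (f g : mpoly n O) (chi chi' : O -> C) (c : nat) (Y : C).
Hypotheses (hchi : has_conductor chi c) (hchi' : has_conductor chi' c).
Hypothesis hY : `|Y| < 1.

Definition shell_integral j : C :=
  cint mu (fun x => shell pi chi j (meval x f) * power_char chi' Y (meval x g)).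

Let shell_fun j (x : 'I_n -> O) := shell pi chi j (meval x f) * power_char chi' Y (meval x g).

Lemma shell_fun_cucont j : cucont (shell_fun j).
Proof.
apply: cucontM.
- by move=> x; apply: (le_trans (shell_norm hpi hchi _ _)); rewrite ler1n.
- by move=> x; apply: (le_trans (power_char_norm hchi' hY _)); rewrite ler1n.
- apply: (@cucont_periodic _ _ _ (j + c.+1)) => x y xy.
  by apply: (shell_congr hpi hchi); apply: (meval_congr hpi).
- exact: (power_char_cucont hchi' hY).
Qed.

(** The partial sum is the integral of the function obtained by discarding the
points with ord f >= N, where the integrand is at most |X|^N. *)
Lemma shell_expansion X N : `|X| < 1 ->
  `|cint mu (fun x => power_char chi X (meval x f) * power_char chi' Y (meval x g)) -
    \sum_(j < N) shell_integral j * X ^+ j| <= `|X| ^+ N.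
Proof.
move=> hX; set h := fun x : 'I_n -> O => _.
have uh : cucont h.
  apply: cucontM.
  - by move=> x; apply: (le_trans (power_char_norm hchi hX _)); rewrite ler1n.
  - by move=> x; apply: (le_trans (power_char_norm hchi' hY _)); rewrite ler1n.
  - exact: (power_char_cucont hchi hX).
  - exact: (power_char_cucont hchi' hY).
have uZ j : cucont (fun x => (- X ^+ j) * shell_fun j x).
  exact/cucontZ/shell_fun_cucont.
have [uS eS] := cucont_sum hpi hmu N uZ.
have -> : cint mu h - \sum_(j < N) shell_integral j * X ^+ j =
    cint mu (fun x => h x + \sum_(j < N) (- X ^+ j) * shell_fun j x).
  rewrite (cintD hpi hmu) // eS -sumrN; congr (_ + _); apply: eq_bigr => j _.
  by rewrite (cintZ hpi hmu) ?mulNr 1?mulrC //; exact: shell_fun_cucont.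
apply: (cint_bound hpi hmu); first exact: cucontD.
move=> x; have -> : h x + \sum_(j < N) (- X ^+ j) * shell_fun j x =
   (power_char chi X (meval x f) - trunc_char pi chi X N (meval x f)) * power_char chi' Y (meval x g).
  rewrite mulrBl; congr (_ + _); rewrite /trunc_char mulr_suml -sumrN.
  by apply: eq_bigr => j _; rewrite mulNr mulrA.
rewrite normrM -[leRHS]mulr1; apply: ler_pM => //.
  exact: (power_char_trunc hchi hX).
exact: (power_char_norm hchi' hY).
Qed.

Variables (kappa r rho B : C).
Hypothesis hnd : newton_nondegenerate R f g.
Hypothesis hk : cancelling chi kappa.
Hypothesis hkappa : `|kappa| <= 1.
Hypotheses (f0 : f != 0) (g0 : g != 0).
Hypotheses (r0 : 0 < r) (r1 : r <= 1) (rho1 : 1 <= rho) (B1 : 1 <= B).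
Hypothesis hB : (qcard K)%:R + rho * B <= (qcard K)%:R * B.
Hypothesis hr : forall k a, is_dmin k f a -> 1 <= r ^+ a * rho ^+ (\sum_l k l).
Hypothesis hrho : forall j, exists M1, forall M, (M1 <= M)%N -> 1 <= r ^+ j * rho ^+ M.

(** The left side is the integral of the coefficient of X^j after
multiplication by 1 - kappa X.  Truncating in the order of g makes it a
function on a grid, up to an error that tends to 0. *)
Lemma shell_integral_decay j :
  `|shell_integral j - kappa * (if j is j'.+1 then shell_integral j' else 0)| <=
  2 * r ^+ (j - c.+1) * B ^+ n.
Proof.
pose H x := dshell pi chi kappa j (meval x f) * power_char chi' Y (meval x g).
have uH : cucont H.
  apply: cucontM.
  - by move=> x; exact: (dshell_norm hpi hchi _ _ hkappa).
  - by move=> x; apply: (le_trans (power_char_norm hchi' hY _)); rewrite ler1n.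
  - apply: (@cucont_periodic _ _ _ (j + c.+1)) => x y xy.
    by apply: (dshell_congr hpi hchi); apply: (meval_congr hpi).
  - exact: (power_char_cucont hchi' hY).
have -> : shell_integral j - kappa * (if j is j'.+1 then shell_integral j' else 0) = cint mu H.
  case: j @H uH => [|j] H uH.
    rewrite mulr0 subr0; congr (cint mu _); apply/funext => x.
    by rewrite /H /dshell mulr0 subr0.
  rewrite -mulNr -(cintZ hpi hmu) -?(cintD hpi hmu); first last.
  - exact: shell_fun_cucont.
  - exact/cucontZ/shell_fun_cucont.
  - exact: shell_fun_cucont.
  congr (cint mu _); apply/funext => x.
  by rewrite /H /dshell mulrBl mulNr mulrA.
apply: norm_le_eps => e e0; have e20 : 0 < e / 2 by rewrite divr_gt0.
have [N hN] := geometric_smallC hY e20; have [M1 hM1] := hrho j.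
apply: (@cint_le _ _ _ hpi _ _ hmu _ _ (maxn M1 (j + N + c.+1)) uH) => M.
rewrite geq_max => /andP[/hM1 h1 h2].
pose T := shell_term pi f g chi chi' kappa Y j N.
have -> : grid_mean pi M H = grid_mean pi M T + grid_mean pi M (fun x => H x - T x).
  by rewrite grid_meanB addrC subrK.
apply: (le_trans (ler_normD _ _)); apply: lerD.
  exact: (grid_mean_shell_term hpi hchi hchi' hnd hk hkappa (ltW hY) f0 g0 r0 r1 rho1 B1 hB hr h2 h1).
apply: grid_mean_bound => x; rewrite /H /T /shell_term -mulrBr normrM.
apply: (@le_trans _ _ (2 * (e / 2)%:C)).
  apply: ler_pM => //; first exact: (dshell_norm hpi hchi _ _ hkappa).
  by apply: le_trans hN; exact: (power_char_trunc hchi' hY).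
by rewrite mulrDl mul1r -rmorphD -splitr.
Qed.

End Coefficients.

(** * Continuation of a rational power series *)

Section PowerSeriesContinuation.
Variable R : realType.
Local Notation C := R[i].
Implicit Types (p q : {poly C}) (x : R).

Definition coef_norm p : C := \sum_(i < size p) `|p`_i|.

Lemma coef_norm_ge0 p : 0 <= coef_norm p.
Proof. exact: sumr_ge0. Qed.

Lemma sum_norm_coef n p : \sum_(i < n) `|p`_i| <= coef_norm p.
Proof.
apply: (@le_trans _ _ (\sum_(i < n + size p) `|p`_i|)).
  by rewrite big_split_ord /= lerDl sumr_ge0.
rewrite addnC big_split_ord /= [X in _ + X]big1 ?addr0 // => i _.
by rewrite nth_default ?normr0 // leq_addr.
Qed.

Lemma horner_le_coef_norm p (z : C) : `|z| <= 1 -> `|p.[z]| <= coef_norm p.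
Proof.
move=> z1; rewrite horner_coef; apply: (le_trans (ler_norm_sum _ _ _)).
apply: ler_sum => i _; rewrite normrM normrX -[leRHS]mulr1.
by apply: ler_wpM2l => //; apply: exprn_ile1.
Qed.

(** The constant coefficient is the limit at 0; once it vanishes, divide by
the variable. *)
Lemma coef_eq0_of_small N p (B : C) : 0 <= B ->
  (forall x, 0 < x -> x < 1 -> `|p.[x%:C]| <= B * x%:C ^+ N) ->
  forall j, (j < N)%N -> p`_j = 0.
Proof.
elim: N p => [//|N IH] p B0 hp.
pose E := \poly_(i < size p) p`_i.+1.
have pE : p = E * 'X + (p`_0)%:P.
  apply/polyP => -[|i]; rewrite coefD coefMX coefC /= ?add0r // addr0 coef_poly.
  by case: ltnP => // h; rewrite nth_default // ltnW.
have n1 x : 0 < x -> x < 1 -> `|x%:C| <= 1 :> C.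
  by move=> x0 x1; rewrite normCR -[1]/(1%:C) lerC gtr0_norm // ltW.
have p0 : p`_0 = 0.
  apply: eq0_eps => e e0; have [S hS] : exists S : R, coef_norm E + B = S%:C.
    have : 0 <= coef_norm E + B by rewrite addr_ge0 ?coef_norm_ge0.
    case: (_ + _) => a b; rewrite lecE /= => /andP[/eqP -> _]; by exists a.
  have S0 : 0 <= S by rewrite -lerC -hS addr_ge0 ?coef_norm_ge0.
  pose x := Num.min (1 / 2) (e / (S + 1)); have S1 : 0 < S + 1 by rewrite ltr_wpDl.
  have x0 : 0 < x by rewrite lt_min !divr_gt0.
  have x1 : x < 1 by rewrite gt_min (_ : 1 / 2 < 1) //; lra.
  have xe : x * S <= e.
    apply: (@le_trans _ _ (e / (S + 1) * (S + 1))); last by rewrite divfK ?gt_eqF.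
    by apply: ler_pM => //; [exact: ltW|rewrite ge_min lexx orbT|rewrite lerDl].
  have -> : p`_0 = p.[x%:C] - E.[x%:C] * x%:C by rewrite {2}pE !hornerE addrC addKr.
  apply: (le_trans (ler_normB _ _)); apply: (@le_trans _ _ ((x * S)%:C)); last by rewrite lerC.
  have -> : (x * S)%:C = x%:C * (coef_norm E + B) by rewrite hS rmorphM.
  rewrite mulrDr addrC; apply: lerD.
    rewrite normrM mulrC normCR (gtr0_norm x0); apply: ler_wpM2l; last exact/horner_le_coef_norm/n1.
    by rewrite -[0]/(0%:C) lerC ltW.
  apply: le_trans (hp x x0 x1) _; rewrite mulrC exprS -mulrA; apply: ler_wpM2l.
    by rewrite -[0]/(0%:C) lerC ltW.
  rewrite -[leRHS]mul1r; apply: ler_wpM2r => //.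
  by rewrite -rmorphXn -[1]/(1%:C) lerC exprn_ile1 // ltW.
case=> [//|j]; rewrite ltnS => jN.
have := IH E B0; move=> /(_ _ j jN); rewrite coef_poly.
case: ltnP => [_|h _]; last by rewrite nth_default // ltnW.
apply=> x x0 x1; have xc : 0 < x%:C :> C by rewrite -[0]/(0%:C) ltrC.
have := hp x x0 x1; rewrite {1}pE p0 !hornerE normrM (gtr0_norm xc) exprS mulrCA mulrC.
by rewrite ler_pM2l.
Qed.

Variables (A : nat -> C) (P Q : {poly C}) (kappa r G : C).
Hypothesis hAQP : forall x, 0 < x -> x < 1 -> exists2 I : C,
  (forall N, `|I - \sum_(j < N) A j * x%:C ^+ j| <= x%:C ^+ N) & Q.[x%:C] * I = P.[x%:C].
Let D j : C := A j - kappa * (if j is j'.+1 then A j' else 0).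
Hypotheses (r0 : 0 < r) (r1 : r <= 1) (G0 : 0 <= G).
Hypothesis hD : forall j, `|D j| <= G * r ^+ j.

(** For each N, the polynomial Q (sum_(j < N) A_j X^j) - P is O(x^N) on real
points of the unit disc, so its coefficients below N vanish; then multiply by
1 - kappa X. *)
Lemma coef_identity j :
  \sum_(i < j.+1) Q`_i * D (j - i) = ((1 - kappa *: 'X) * P)`_j.
Proof.
pose S N : {poly C} := \poly_(i < N) A i.
have h0 N i : (i < N)%N -> (Q * S N - P)`_i = 0.
  apply: (@coef_eq0_of_small _ _ (coef_norm Q) (coef_norm_ge0 Q)) => x x0 x1.
  have [I hI hQ] := hAQP x0 x1; rewrite hornerD hornerN hornerM -hQ -mulrBr normrM.
  apply: ler_pM => //.
    by apply: horner_le_coef_norm; rewrite normCR -[1]/(1%:C) lerC gtr0_norm // ltW.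
  by rewrite distrC horner_poly.
have hA N i : (i < N)%N -> (Q * S N)`_i = P`_i.
  by move=> /h0 /eqP; rewrite coefB subr_eq0 => /eqP.
have E1 : \sum_(i < j.+1) Q`_i * A (j - i) = P`_j.
  rewrite -(hA j.+1 j) // coefM; apply: eq_bigr => i _.
  by rewrite coef_poly ltnS leq_subr.
rewrite mulrBl mul1r coefB -scalerAl coefZ coefXM -E1 /D.
under eq_bigr do rewrite mulrBr.
rewrite sumrB; congr (_ - _).
case: j {E1} => [|j]; first by rewrite big_ord1 !mulr0.
rewrite big_ord_recr /= subnn !mulr0 addr0 /= -(hA j.+1 j) // coefM mulr_sumr.
apply: eq_bigr => i _; rewrite coef_poly ltnS leq_subr subSn ?leq_ord //.
by rewrite mulrCA.
Qed.

(** The bound holds for the truncations, whose difference from the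
identity in degree N only involves the decaying coefficients D. *)
Lemma continuation_bound (X : C) : r * `|X| < 1 ->
  `|(1 - kappa * X) * P.[X]| <= `|Q.[X]| * (G / (1 - r * `|X|)).
Proof.
move=> rX; set a := r * `|X|; have a0 : 0 <= a by rewrite mulr_ge0 // ltW.
pose L : {poly C} := 1 - kappa *: 'X.
pose T N : {poly C} := \poly_(i < N) D i.
have hT N : `|(T N).[X]| <= G / (1 - a).
  rewrite horner_poly; apply: (le_trans (ler_norm_sum _ _ _)).
  apply: (@le_trans _ _ (\sum_(i < N) G * a ^+ i)).
    apply: ler_sum => i _; rewrite normrM normrX exprMn mulrA.
    by apply: ler_wpM2r; rewrite ?exprn_ge0.
  rewrite -mulr_sumr; apply: ler_wpM2l => //.
  rewrite -[leRHS]mul1r ler_pdivlMr ?subr_gt0 // mulrC -[_ * _]opprK -mulNr opprB -subrX1.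
  by rewrite opprB gerBl exprn_ge0.
pose dQ := size Q; pose dP := size (L * P).
pose M : C := dQ%:R * (coef_norm Q * (G / r ^+ dQ)).
have M0 : 0 <= M by rewrite !mulr_ge0 ?coef_norm_ge0 ?invr_ge0 ?exprn_ge0 // ltW.
(* only the coefficients of degrees N to N + dQ remain, and they decay *)
have hE N : (dP + dQ <= N)%N -> `|(Q * T N - L * P).[X]| <= M * a ^+ N.
  move=> hN; rewrite (@horner_coef_wide _ (N + dQ)); last first.
    rewrite (leq_trans (size_polyD _ _)) // size_polyN geq_max; apply/andP; split.
      apply: leq_trans (size_polyMleq _ _) (leq_trans (leq_pred _) _).
      by rewrite addnC; apply: leq_add => //; apply: size_poly.
    by rewrite -/dP; lia.
  rewrite big_split_ord /= big1 ?add0r => [|i _]; last first.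
    rewrite (_ : (Q * T N - L * P)`_i = 0) ?mul0r // coefB -coef_identity coefM.
    apply/eqP; rewrite subr_eq0; apply/eqP/eq_bigr => l _.
    by rewrite coef_poly (leq_ltn_trans (leq_subr _ _)).
  apply: (le_trans (ler_norm_sum _ _ _)); rewrite /M -mulrA mulr_natl.
  rewrite -[X in _ *+ X](card_ord dQ) -sumr_const; apply: ler_sum => i _.
  have P0 : (L * P)`_(N + i) = 0.
    by apply: nth_default; apply: leq_trans (leq_addr _ _); apply: leq_trans hN; apply: leq_addr.
  rewrite coefB P0 subr0 normrM normrX.
  apply: (@le_trans _ _ ((coef_norm Q * (G / r ^+ dQ) * r ^+ (N + i)) * `|X| ^+ (N + i))).
    apply: ler_wpM2r; first exact: exprn_ge0.
    rewrite coefM; apply: (le_trans (ler_norm_sum _ _ _)).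
    rewrite -mulrA; apply: (@le_trans _ _ ((\sum_(l < (N + i).+1) `|Q`_l|) * (G / r ^+ dQ * r ^+ (N + i)))); last first.
      apply: ler_wpM2r; last exact: sum_norm_coef.
      by rewrite !mulr_ge0 ?invr_ge0 ?exprn_ge0 // ltW.
    rewrite mulr_suml; apply: ler_sum => l _; rewrite normrM.
    have [lQ|lQ] := ltnP l dQ; last by rewrite nth_default // normr0 !mul0r.
    apply: ler_wpM2l => //; rewrite coef_poly; case: ifP => [_|_]; last first.
      by rewrite normr0 !mulr_ge0 ?invr_ge0 ?exprn_ge0 // ltW.
    apply: (le_trans (hD _)); rewrite -mulrA; apply: ler_wpM2l => //.
    rewrite mulrC ler_pdivlMr ?exprn_gt0 // -exprD; apply: ler_wiXn2l => //; first exact: ltW.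
    by have := ltn_ord l; lia.
  rewrite -[leLHS]mulrA -exprMn -/a; apply: ler_wpM2l.
    by rewrite !mulr_ge0 ?coef_norm_ge0 ?invr_ge0 ?exprn_ge0 // ltW.
  by apply: ler_wiXn2l => //; [exact: ltW|exact: leq_addr].
apply: norm_le_eps => e e0.
have [M' hM'] : exists M' : R, M = M'%:C.
  by case: M M0 {hE} => u v; rewrite lecE /= => /andP[/eqP -> _]; exists u.
have [a' ha'] : exists a' : R, a = a'%:C.
  by exists (complex.Re `|a|); rewrite -normE ger0_norm.
have M'0 : 0 < M' + 1 by rewrite ltr_wpDl // -lerC -hM'.
have a'0 : 0 <= a' by rewrite -lerC -ha'.
have a'1 : a' < 1 by rewrite -ltrC -ha'.
have [N1 hN1] := geometric_small a'0 a'1 (divr_gt0 e0 M'0).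
have := hE _ (leq_maxl (dP + dQ) N1); set N := maxn _ _ => hEN.
have -> : (1 - kappa * X) * P.[X] = Q.[X] * (T N).[X] - (Q * T N - L * P).[X].
  rewrite hornerD hornerN !hornerM opprD opprK addrA subrr add0r.
  by rewrite /L hornerD hornerN hornerZ hornerX hornerC.
apply: (le_trans (ler_normB _ _)); apply: lerD.
  by rewrite normrM; apply: ler_wpM2l.
apply: (le_trans hEN); rewrite hM' ha' -rmorphXn -rmorphM lerC.
apply: (@le_trans _ _ ((M' + 1) * (e / (M' + 1)))); last by rewrite mulrC divfK ?gt_eqF.
apply: ler_pM => //; [by rewrite -lerC -hM'|exact: exprn_ge0|by rewrite lerDl|].
by apply: le_trans hN1; apply: ler_wiXn2l => //; [exact: ltW|exact: leq_maxr].
Qed.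

End PowerSeriesContinuation.

(** * The zeta integral as a function of q^-s *)

Section ComplexPowers.
Variable R : realType.
Local Notation C := R[i].
Implicit Types (s z : C) (x : R).

Lemma cexpD s z : cexp (s + z) = cexp s * cexp z.
Proof.
case: s z => a b [a' b']; apply/eqP; rewrite eq_complex /= expRD cosD sinD.
by apply/andP; split; apply/eqP; ring.
Qed.

Lemma cexp0 : cexp (0 : C) = 1.
Proof. by apply/eqP; rewrite eq_complex /= expR0 cos0 sin0 mulr1 mulr0 !eqxx. Qed.

Lemma cexpR x : cexp x%:C = (expR x)%:C.
Proof. by apply/eqP; rewrite eq_complex /= cos0 sin0 mulr1 mulr0 !eqxx. Qed.

Lemma norm_cexp s : `|cexp s| = (expR (complex.Re s))%:C.
Proof.
by rewrite normc_def /= !exprMn -mulrDr cos2Dsin2 mulr1 sqrtr_sqr ger0_norm ?expR_ge0.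
Qed.

Lemma cexpMn s n : cexp (s *+ n) = cexp s ^+ n.
Proof.
by elim: n => [|n IH]; rewrite ?mulr0n ?cexp0 // mulrS cexpD IH exprS.
Qed.

Lemma cpowE x s : 0 < x -> cpow x s = cexp ((ln x)%:C * s).
Proof. by move=> x0; rewrite /cpow gt_eqF. Qed.

Lemma norm_cpow x s : 0 < x -> `|cpow x s| = (expR (ln x * complex.Re s))%:C.
Proof.
move=> x0; rewrite cpowE // norm_cexp; case: s => a b /=.
by rewrite mul0r subr0.
Qed.

Lemma cpowD x s z : 0 < x -> cpow x (s + z) = cpow x s * cpow x z.
Proof. by move=> x0; rewrite !cpowE // mulrDr cexpD. Qed.

Lemma cpowN_mul x s : 0 < x -> cpow x (- s) * cpow x s = 1.
Proof. by move=> x0; rewrite -cpowD // addNr cpowE // mulr0 cexp0. Qed.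

Lemma cpow_real x (y : R) : 0 < x -> cpow x y%:C = (expR (ln x * y))%:C.
Proof. by move=> x0; rewrite cpowE // -rmorphM cexpR. Qed.

End ComplexPowers.

Section ZetaAsIntegral.
Variables (R : realType) (K : localFieldType) (pi : valuation_ring K).
Hypothesis hpi : uniformizer pi.
Local Notation O := (valuation_ring K).
Local Notation C := R[i].
Variables (n : nat) (mu : {measure set (Kn K n) -> \bar R}).
Local Notation qR := ((qcard K)%:R : R).

Lemma qcard_gt1 : (1 < qcard K)%N.
Proof. exact: card_finNzRing_gt1. Qed.

Lemma qR_gt1 : 1 < qR. Proof. by rewrite ltr1n qcard_gt1. Qed.
Lemma qR_gt0 : 0 < qR. Proof. exact: lt_trans ltr01 qR_gt1. Qed.
Lemma lnq_gt0 : 0 < ln qR. Proof. by rewrite ln_gt0 // qR_gt1. Qed.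

Lemma map_valD (p r : mpoly n O) :
  map_mpoly val (p + r) = map_mpoly val p + map_mpoly val r :> mpoly n K.
Proof. by rewrite raddfD. Qed.

Lemma evalK_coords (f : mpoly n O) (x : 'rV[K]_n) : On x ->
  evalK f x = val (meval (coords x) f).
Proof.
move=> xO; rewrite /evalK; elim/mpolyind: f => [|c m p _ _ IH].
  by rewrite (raddf0 (map_mpoly val)) !meval0 rmorph0.
rewrite (_ : map_mpoly val (c *: mpolyX O m + p) =
    val c *: mpolyX K m + map_mpoly val p); last first.
  by rewrite map_valD map_mpolyZ map_mpolyX.
rewrite !mevalD IH !mevalZ !mevalX rmorphD rmorphM rmorph_prod.
congr (_ * _ + _); apply: eq_bigr => l _; rewrite rmorphXn /=.
by rewrite -(val_coords l xO).
Qed.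

Lemma char_cpow (chi : O -> C) (s : C) (y : O) : 
  chi (ac pi (val y)) * cpow (absK R (val y)) s =
  power_char pi chi (cpow qR (- s)) y.
Proof.
rewrite /absK /power_char val_eq0; case: eqVneq => [_|y0].
  by rewrite /cpow eqxx mulr0.
rewrite mulrC; congr (_ * _); rewrite nu_ord // -exprnN.
have q0 := qR_gt0; rewrite !cpowE ?invr_gt0 ?exprn_gt0 // -cexpMn; congr cexp.
rewrite lnV ?posrE ?exprn_gt0 // lnXn // rmorphN rmorphMn /=.
by rewrite mulNr mulrN mulrnAl mulNrn.
Qed.

Lemma zeta_integralE (chi chi' : O -> C) (f g : mpoly n O) s1 s2 :
  zeta_integral pi mu chi chi' f g s1 s2 =
  cint mu (fun x => power_char pi chi (cpow qR (- s1)) (meval x f) *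
                    power_char pi chi' (cpow qR (- s2)) (meval x g)).
Proof.
rewrite /zeta_integral /cint /cintegral.
have E x : On x -> chi (ac pi (evalK f x)) * chi' (ac pi (evalK g x)) *
    cpow (absK R (evalK f x)) s1 * cpow (absK R (evalK g x)) s2 =
    power_char pi chi (cpow qR (- s1)) (meval (coords x) f) *
    power_char pi chi' (cpow qR (- s2)) (meval (coords x) g).
  by move=> xO; rewrite !evalK_coords // -!char_cpow; ring.
by congr (_ +i* _); apply: eq_Rintegral => x; rewrite inE => xO; rewrite E.
Qed.

Definition specialize2 (P : mpoly 2 C) (Y : C) : {poly C} :=
  mmap polyC (fun i : 'I_2 => if i == 0 then 'X else Y%:P) P.

Lemma horner_specialize2 P Y X :
  (specialize2 P Y).[X] = meval (fun i : 'I_2 => if i == 0 then X else Y) P.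
Proof.
rewrite /specialize2; elim/mpolyind: P => [|c m p _ _ IH].
  by rewrite raddf0 meval0 horner0.
rewrite raddfD /= hornerD IH mmapZ mmapX mevalD mevalZ mevalX hornerM hornerC.
congr (_ * _ + _); rewrite /mmap1 horner_prod; apply: eq_bigr => i _.
by rewrite horner_exp; case: ifP; rewrite ?hornerX ?hornerC.
Qed.

Lemma eval_qE P s1 s2 :
  eval_q K P s1 s2 = meval (fun i : 'I_2 => if i == 0 then cpow qR (- s1) else cpow qR (- s2)) P.
Proof. by apply: meval_eq => i; case: ifP. Qed.

(** On the line s2 = -s1 one has Y = 1/X. *)
Lemma laurent_line (Q : mpoly 2 C) : exists d (W : {poly C}), forall X, X != 0 ->
  X ^+ d * meval (fun i : 'I_2 => if i == 0 then X else X^-1) Q = W.[X].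
Proof.
elim/mpolyind: Q => [|c m p _ _ [d [W hW]]].
  by exists 0%N, 0 => X X0; rewrite meval0 mulr0 horner0.
pose a := m (0 : 'I_2)%R; pose b := m (1 : 'I_2)%R.
exists (d + b)%N, (c *: 'X^(a + d) + 'X^b * W) => X X0.
rewrite mevalD mevalZ mevalX big_ord_recl big_ord1.
rewrite (_ : lift ord0 ord0 = 1 :> 'I_2) /=; last exact: val_inj.
rewrite -/a -/b !hornerE -hW // !exprD exprVn.
have E (k xd xb xa M : C) : xb != 0 ->
    xd * xb * (k * xa * xb^-1 + M) = k * (xa * xd) + xb * (xd * M).
  by move=> xb0; field.
by apply: E; rewrite expf_neq0.
Qed.

End ZetaAsIntegral.

(** * The continuation beyond the domain of convergence *)

Section ContinuedZeta.
Variables (R : realType) (K : localFieldType) (pi : valuation_ring K).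
Hypothesis hpi : uniformizer pi.
Local Notation O := (valuation_ring K).
Local Notation C := R[i].
Variables (n : nat) (mu : {measure set (Kn K n) -> \bar R}).
Hypothesis hmu : is_haar mu.
Variables (f g : mpoly n O) (chi chi' : O -> C) (c : nat).
Hypotheses (hchi : has_conductor chi c) (hchi' : has_conductor chi' c).
Variables (kappa r rho B : C).
Hypothesis hnd : newton_nondegenerate R f g.
Hypothesis hk : cancelling chi kappa.
Hypothesis hkappa : `|kappa| <= 1.
Hypotheses (f0 : f != 0) (g0 : g != 0).
Hypotheses (r0 : 0 < r) (r1 : r <= 1) (rho1 : 1 <= rho) (B1 : 1 <= B).
Hypothesis hB : (qcard K)%:R + rho * B <= (qcard K)%:R * B.
Hypothesis hr : forall k a, is_dmin k f a -> 1 <= r ^+ a * rho ^+ (\sum_l k l).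
Hypothesis hrho : forall j, exists M1, forall M, (M1 <= M)%N -> 1 <= r ^+ j * rho ^+ M.
Variables (P Q : mpoly 2 C).
Hypothesis hPQ : zeta_continuation pi mu chi chi' f g P Q.
Local Notation qR := ((qcard K)%:R : R).

Lemma zeta_continuation_bound s1 s2 : 0 < complex.Re s2 ->
  r * `|cpow qR (- s1)| < 1 ->
  `|(1 - kappa * cpow qR (- s1)) * eval_q K P s1 s2| <=
  `|eval_q K Q s1 s2| * ((2 * B ^+ n / r ^+ c.+1) / (1 - r * `|cpow qR (- s1)|)).
Proof.
move=> hs2 hX; rewrite !eval_qE -!horner_specialize2.
have q0 := qR_gt0 R K; have lq0 := lnq_gt0 R K.
set Y := cpow qR (- s2).
have hY : `|Y| < 1.
  rewrite norm_cpow // -[ltRHS]/(1%:C) ltrC -[ltRHS]expR0 ltr_expR.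
  by move: hs2; case: (s2) => u v /= u0; rewrite mulrN oppr_lt0 mulr_gt0.
apply: (@continuation_bound R (shell_integral pi mu f g chi chi' Y)) => //.
- move=> x x0 x1; pose s := (- (ln x / ln qR))%:C : C.
  have hs : 0 < complex.Re s by rewrite /s /= oppr_gt0 pmulr_llt0 ?invr_gt0 // ln_lt0 // x0.
  have hx : cpow qR (- s) = x%:C.
    rewrite /s -rmorphN opprK cpow_real // mulrC divfK ?gt_eqF //.
    by rewrite lnK ?posrE.
  have hxn : `|x%:C| < 1 :> C by rewrite normCR -[1]/(1%:C) ltrC gtr0_norm.
  exists (zeta_integral pi mu chi chi' f g s s2) => [N|].
    rewrite zeta_integralE // hx -/Y.
    have := shell_expansion hpi hmu f g hchi hchi' hY N hxn.
    by rewrite normCR (gtr0_norm x0).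
  by have [_ /(_ s s2 hs hs2)] := hPQ; rewrite !eval_qE -!horner_specialize2 hx.
- have B0 : 0 <= B by rewrite (le_trans ler01).
  by rewrite !mulr_ge0 ?invr_ge0 ?exprn_ge0 // ltW.
move=> j; apply: (le_trans (shell_integral_decay hpi hmu hchi hchi' hY hnd hk hkappa f0 g0 r0 r1 rho1 B1 hB hr hrho j)).
rewrite mulrAC -[leRHS]mulrA; apply: ler_wpM2l.
  by rewrite mulr_ge0 ?exprn_ge0 // (le_trans ler01).
rewrite mulrC ler_pdivlMr ?exprn_gt0 // -exprD; apply: ler_wiXn2l => //; first exact: ltW.
by rewrite addnC -leq_subLR.
Qed.

End ContinuedZeta.

(** * The diagonal point of the Newton polyhedron *)

Section NewtonDiagonal.
Variables (R : realType) (K : localFieldType) (n : nat).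
Local Notation O := (valuation_ring K).
Implicit Types (f g : mpoly n O).

Lemma weightD (k : 'I_n -> nat) (m1 m2 : multinom n) :
  weight k (mnm_add m1 m2) = (weight k m1 + weight k m2)%N.
Proof.
by rewrite /weight -big_split; apply: eq_bigr => l _; rewrite /= mnmDE mulnDr.
Qed.

(** An exponent of fg is the sum of an exponent of f and one of g, and the
latter has a non-negative weight. *)
Lemma is_dmin_diag f g (t : R) k a :
  closure (newton R (f * g)) (const_mx t) -> is_dmin k f a -> a%:R <= t * (\sum_l k l)%:R.
Proof.
move=> ht [ha _]; apply: (closure_newton_diag _ ht) => m /msuppM_le /allpairsP[[m1 m2] /= [h1 _ ->]].
by rewrite weightD; apply: leq_trans (ha _ h1) (leq_addr _ _).
Qed.

Lemma meval_at0 f : meval (fun=> 0) f = mcoeff mnm0 f.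
Proof.
elim/mpolyind: f => [|c m p _ _ IH]; first by rewrite meval0 mcoeff0.
rewrite mevalD IH mcoeffD mevalZ mcoeffZ mevalX mcoeffX; congr (_ * _ + _).
have [->|m0] := eqVneq m mnm0; first by rewrite big1 // => i _; rewrite mnm0E expr0.
have [i hi] : exists i, m i != 0%N.
  apply/existsP; rewrite -negb_forall; apply: contra m0 => /forallP h.
  by apply/eqP/mnmP => i; rewrite mnm0E; apply/eqP.
by rewrite (bigD1 i) //= expr0n (negPf hi) mul0r.
Qed.

(** Every exponent of f has a positive entry, so d(k, Gamma(f)) >= 1 for
k = (1, ..., 1). *)
Lemma diag_gt0 f g (t : R) : f != 0 -> meval (fun=> 0) f = 0 ->
  closure (newton R (f * g)) (const_mx t) -> 0 < t.
Proof.
move=> f0 ff ht; have [a ha] := is_dmin_ex (fun=> 1%N) f0.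
have a0 : (0 < a)%N.
  case: ha => _ [m hm <-]; rewrite lt0n; apply: contraTneq hm => h.
  have -> : m = mnm0.
    apply/mnmP => i; rewrite mnm0E; apply/eqP; rewrite -leqn0 -h /weight (bigD1 i) //= mul1n.
    exact: leq_addr.
  by rewrite mcoeff_msupp -meval_at0 ff eqxx.
have := is_dmin_diag ht ha; rewrite ltNge => h; apply/negP => t0.
have : (a%:R : R) <= 0 by apply: (le_trans h); rewrite mulr_le0_ge0.
by rewrite lern0 -leqn0 leqNgt a0.
Qed.

End NewtonDiagonal.

(** * Absence of poles *)

Section NoPole.
Variables (R : realType) (K : localFieldType) (pi : valuation_ring K).
Hypothesis hpi : uniformizer pi.
Local Notation O := (valuation_ring K).
Local Notation C := R[i].
Variables (n : nat) (mu : {measure set (Kn K n) -> \bar R}).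
Hypothesis hmu : is_haar mu.
Variables (f g : mpoly n O) (chi : O -> C) (c : nat).
Hypothesis hchi : has_conductor chi c.
Hypothesis hnd : newton_nondegenerate R f g.
Hypotheses (f0 : f != 0) (g0 : g != 0).
Variables (t0 k0 : R).
Hypotheses (t0_gt0 : 0 < t0) (k0_ge0 : 0 <= k0) (k0_le1 : k0 <= 1).
Hypothesis ht : forall k a, is_dmin k f a -> a%:R <= t0 * (\sum_l k l)%:R.
Hypothesis hk : cancelling chi k0%:C.
Local Notation q := ((qcard K)%:R : R).

(** Take rho = q^theta and r = q^(-theta / t0).  Then r^a rho^(|k|) is at least 1
for a <= t0 |k|, and r |q^-z| < 1 exactly when -Re(z) t0 < theta. *)
Lemma line_bound (theta : R) : 0 < theta -> theta < 1 ->
  exists2 G : R, 0 <= G & forall (P Q : mpoly 2 C) (z : C),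
  zeta_continuation pi mu chi (fun u => (chi u)^-1) f g P Q ->
  complex.Re z < 0 -> - complex.Re z * t0 < theta ->
  `|1 - k0%:C * cpow q (- z)| * `|eval_q K P z (- z)| <=
  `|eval_q K Q z (- z)| *
    (G / (1 - expR (ln q * (- complex.Re z - theta / t0))))%:C.
Proof.
move=> th0 th1; have q0 := qR_gt0 R K; have q1 := qR_gt1 R K; have lq0 := lnq_gt0 R K.
pose r := expR (- (ln q * (theta / t0))); pose rho := expR (ln q * theta).
have rho_q : rho < q by rewrite /rho -[ltRHS](@lnK _ q) ?posrE // ltr_expR gtr_pMr.
have rho1 : 1 <= rho by rewrite -[leLHS]expR0 ler_expR mulr_ge0 // ltW.
have r0 : 0 < r by apply: expR_gt0.
have r1 : r <= 1.
  by rewrite -[leRHS]expR0 ler_expR oppr_le0 !mulr_ge0 ?invr_ge0 // ltW.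
pose B := q / (q - rho); have qr : 0 < q - rho by rewrite subr_gt0.
have B1 : 1 <= B by rewrite ler_pdivlMr // mul1r; lra.
have hB : q + rho * B <= q * B by rewrite le_eqVlt; apply/orP; left; apply/eqP; rewrite /B; field; rewrite gt_eqF.
pose G := 2 * B ^+ n / r ^+ c.+1.
have G0 : 0 <= G.
  have B0 : 0 <= B by rewrite (le_trans ler01).
  by rewrite !mulr_ge0 ?invr_ge0 ?exprn_ge0 // ltW.
exists G => // P Q z hPQ z0 zth.
have rX : r%:C * `|cpow q (- z)| = (expR (ln q * (- complex.Re z - theta / t0)))%:C.
  rewrite norm_cpow // -rmorphM -expRD; congr (expR _)%:C.
  by case: (z) => u v /=; ring.
have := @zeta_continuation_bound R K pi hpi n mu hmu f g chi (fun u => (chi u)^-1) c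
  hchi (has_conductorV hchi) k0%:C r%:C rho%:C B%:C hnd hk _ f0 g0 _ _ _ _ _ _ _ P Q hPQ z (- z).
rewrite rX normrM.
have -> : (2 * B%:C ^+ n / r%:C ^+ c.+1) / (1 - (expR (ln q * (- complex.Re z - theta / t0)))%:C) =
  (G / (1 - expR (ln q * (- complex.Re z - theta / t0))))%:C.
  by rewrite /G !(rmorphM, fmorphV, rmorphXn, rmorphB, rmorph1, rmorph_nat).
apply.
- by rewrite normCR ger0_norm // -[leRHS]/(1%:C) lerC.
- by rewrite -[ltLHS]/(0%:C) ltrC.
- by rewrite -[leRHS]/(1%:C) lerC.
- by rewrite -[leLHS]/(1%:C) lerC.
- by rewrite -[leLHS]/(1%:C) lerC.
- by have := hB; rewrite -lerC !(rmorphD, rmorphM, rmorph_nat).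
- move=> k a /ht hka; rewrite -!rmorphXn -rmorphM -[leLHS]/(1%:C) lerC.
  rewrite /r /rho -!expRM_natl -expRD -[leLHS]expR0 ler_expR.
  have -> : a%:R * - (ln q * (theta / t0)) + (\sum_l k l)%:R * (ln q * theta) =
     ln q * theta / t0 * (t0 * (\sum_l k l)%:R - a%:R).
    by field; rewrite gt_eqF.
  by rewrite !mulr_ge0 ?invr_ge0 ?subr_ge0 // ltW.
- move=> j; exists (Num.bound (j%:R / t0)) => M hM.
  rewrite -!rmorphXn -rmorphM -[leLHS]/(1%:C) lerC.
  rewrite /r /rho -!expRM_natl -expRD -[leLHS]expR0 ler_expR.
  have -> : j%:R * - (ln q * (theta / t0)) + M%:R * (ln q * theta) =
     ln q * theta * (M%:R - j%:R / t0).
    by field; rewrite gt_eqF.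
  rewrite !mulr_ge0 ?(ltW lq0) ?(ltW th0) // subr_ge0 ltW //.
  have jt : 0 <= j%:R / t0 by rewrite divr_ge0 // ltW.
  by apply: (lt_le_trans (archi_boundP jt)); rewrite ler_nat.
- by case: (z) z0 => u v /=; rewrite oppr_gt0.
rewrite -[ltRHS]/(1%:C) ltrC -[ltRHS]expR0 ltr_expR pmulr_rlt0 // subr_lt0.
by rewrite ltr_pdivlMr.
Qed.

Lemma norm_cpowN (z : C) : `|cpow q (- z)| = (expR (- (ln q * complex.Re z)))%:C.
Proof.
rewrite norm_cpow ?qR_gt0 //; congr (expR _)%:C.
by case: z => u v /=; rewrite mulrN.
Qed.

(** On the line, Q is a non-zero Laurent polynomial in q^-z, and the points
s + d0 / (k + 1) give infinitely many values of q^-z. *)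
Lemma nonvanishing_points (Q : mpoly 2 C) (s : C) (d0 : R) : 0 < d0 ->
  (exists z, eval_q K Q z (- z) != 0) ->
  exists d, [/\ 0 < d, d <= d0 & eval_q K Q (s + d%:C) (- (s + d%:C)) != 0].
Proof.
move=> d00 [z0 hz0]; have q0 := qR_gt0 R K; have lq0 := lnq_gt0 R K.
have [d [W hW]] := laurent_line Q.
have Xn0 z : cpow q (- z) != 0 :> C.
  by have := cpowN_mul z q0; apply: contra_eq_neq => ->; rewrite mul0r eq_sym oner_eq0.
have hQW z : cpow q (- z) ^+ d * eval_q K Q z (- z) = W.[cpow q (- z)].
  rewrite -hW // eval_qE opprK; congr (_ * _); apply: meval_eq => i; case: ifP => // _.
  by apply: (mulfI (Xn0 z)); rewrite cpowN_mul // divff.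
have W0 : W != 0.
  apply: contraNneq hz0 => WE; have := hQW z0; rewrite WE horner0 => /eqP.
  by rewrite mulf_eq0 expf_eq0 (negPf (Xn0 _)) andbF.
pose dl k : R := d0 / k.+1%:R; pose Xp k : C := cpow q (- (s + (dl k)%:C)).
have Xinj : injective Xp.
  move=> j k /(congr1 (fun x => `|x|)); rewrite !norm_cpowN => /complexI/expR_inj/oppr_inj.
  move=> /(mulfI (lt0r_neq0 lq0)); case: (s) => u v /= /addrI.
  move=> /(mulfI (lt0r_neq0 d00)) /invr_inj /eqP; rewrite eqr_nat eqSS => /eqP //.
have : ~~ all (root W) [seq Xp k | k <- iota 0 (size W)].
  apply/negP => hall; have := max_poly_roots W0 hall.
  by rewrite map_inj_uniq // iota_uniq size_map size_iota ltnn => /(_ isT).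
rewrite all_map -has_predC => /hasP[k _ /= hk'].
exists (dl k); split; first by rewrite divr_gt0.
  by rewrite ler_pdivrMr // ler_peMr ?ler1n // ltW.
by apply: contraNneq hk' => e; apply/eqP; rewrite -/(Xp k) /Xp -hQW e mulr0.
Qed.

(** Near s, on the horizontal half-line to the right of s, the bound of
[line_bound] stays finite and |1 - k0 q^-z| stays away from 0. *)
Lemma no_pole (Z : C -> C) (s : C) : is_zeta pi mu chi f g Z ->
  complex.Re s < 0 -> - (1 / t0) < complex.Re s ->
  k0 * expR (- (ln q * complex.Re s)) != 1 -> ~ is_pole Z s.
Proof.
move=> [P [Q [hPQ hQ hZ]]] s0 st km pole; have lq0 := lnq_gt0 R K.
set sg := complex.Re s in s0 st km.
have tau0 : 0 < - sg * t0 by rewrite mulr_gt0 ?oppr_gt0.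
have tau1 : - sg * t0 < 1 by rewrite -ltr_pdivlMr // ltrNl.
pose th := (1 + - sg * t0) / 2.
have [th0 th1] : 0 < th /\ th < 1 by rewrite /th; lra.
have tht : - sg * t0 < th by rewrite /th; lra.
have [G G0 hG] := line_bound th0 th1.
(* if k0 q^(-Re s) > 1, then d1 keeps k0 q^(-Re z) above the midpoint between
   k0 q^(-Re s) and 1 *)
have [eta [d1 [eta0 d10 heta]]] : exists eta d1, [/\ 0 < eta, 0 < d1 &
   forall d, 0 < d -> d <= d1 -> eta <= `|1 - k0 * expR (- (ln q * (sg + d)))|].
  have m0 : 0 <= k0 * expR (- (ln q * sg)) by rewrite mulr_ge0 // expR_ge0.
  set m := k0 * _ in km m0.
  have mE d : k0 * expR (- (ln q * (sg + d))) = m * expR (- (ln q * d)).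
    by rewrite mulrDr opprD expRD mulrA.
  have [m1|m1] : m < 1 \/ 1 < m by move: km; rewrite neq_lt => /orP.
    exists (1 - m), 1; split; [by rewrite subr_gt0|by []|] => d d0 _.
    rewrite mE; apply: le_trans (ler_norm _); rewrite lerD2l lerN2.
    by rewrite ler_piMr // -[leRHS]expR0 ler_expR oppr_le0 mulr_ge0 // ltW.
  pose w := 2 * m / (1 + m); have w1 : 1 < w by rewrite /w ltr_pdivlMr; lra.
  exists ((m - 1) / 2), (ln w / ln q); split; [lra|by rewrite divr_gt0 // ln_gt0|].
  move=> d d0; rewrite ler_pdivlMr // mulrC => dw.
  rewrite mE distrC; apply: le_trans (ler_norm _).
  have : w^-1 <= expR (- (ln q * d)).
    rewrite -[leLHS]lnK ?posrE ?invr_gt0; last by apply: lt_trans w1.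
    by rewrite ler_expR lnV ?posrE ?lerN2 //; apply: lt_trans w1.
  move=> /(ler_wpM2l m0); rewrite /w invfM invrK.
  have -> : m * ((2 * m)^-1 * (1 + m)) = (1 + m) / 2 by field; rewrite gt_eqF // (lt_trans ltr01).
  lra.
pose E := expR (ln q * (- sg - th / t0)).
have E1 : 0 < 1 - E.
  rewrite subr_gt0 -[ltRHS]expR0 ltr_expR pmulr_rlt0 // subr_lt0.
  by rewrite ltr_pdivlMr.
pose M := G / (1 - E) / eta + 1.
move: pole => /cvgryPge/(_ M) /nbhs_ballP[e /= e0 he].
have [e' ee'] : exists e' : R, e = e'%:C.
  by case: e e0 {he} => u v; rewrite ltcE /= => /andP[/eqP -> _]; exists u.
have e'0 : 0 < e' by rewrite -ltrC -ee'.
pose d0 := Num.min (Num.min d1 (e' / 2)) (- sg / 2).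
have d00 : 0 < d0 by rewrite !lt_min d10 !divr_gt0 // oppr_gt0.
have [d [dp dd0 hd]] := nonvanishing_points s d00 hQ.
have [dd1 dde dds] : [/\ d <= d1, d <= e' / 2 & d <= - sg / 2].
  by move: dd0; rewrite !le_min => /andP[/andP[]].
set z := s + d%:C in hd.
have zR : complex.Re z = sg + d by rewrite /z /sg; case: (s) => u v.
have := he z; rewrite /ball /= => /(_ _ _).
have -> : `|s - z| < e.
  rewrite /z opprD addrA subrr add0r normrN normCR gtr0_norm // ee' ltrC; lra.
have -> : z != s.
  by rewrite /z -subr_eq0 addrC addKr -normr_gt0 normCR gtr0_norm // -[ltLHS]/(0%:C) ltrC.
move=> /(_ isT isT) hM.
have hz0 : complex.Re z < 0 by rewrite zR; lra.
have hzt : - complex.Re z * t0 < th.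
  apply: le_lt_trans tht; rewrite zR; apply: ler_wpM2r; first exact: ltW.
  by rewrite lerN2 lerDl ltW.
have h1 := hG P Q z hPQ hz0 hzt.
have h2 : `|1 - k0%:C * cpow q (- z)| * `|Z z| <=
    (G / (1 - expR (ln q * (- complex.Re z - th / t0))))%:C.
  by rewrite hZ // normrM normfV mulrA ler_pdivrMr ?normr_gt0 // [leRHS]mulrC.
have h3 : eta%:C <= `|1 - k0%:C * cpow q (- z)|.
  apply: le_trans (ler_dist_dist _ _); rewrite normr1 normrM norm_cpowN normCR.
  rewrite (ger0_norm k0_ge0) -rmorphM -[X in `|X - _|]/(1%:C) -rmorphB normCR lerC zR.
  exact: heta.
have h4 : G / (1 - expR (ln q * (- complex.Re z - th / t0))) <= G / (1 - E).
  apply: ler_wpM2l => //; rewrite lef_pV2 ?posrE //.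
    rewrite lerD2l lerN2 ler_expR ler_pM2l // lerD2r lerN2 zR lerDl; exact: ltW.
  apply: lt_le_trans E1 _.
  rewrite lerD2l lerN2 ler_expR ler_pM2l // lerD2r lerN2 zR lerDl; exact: ltW.
have h5 : eta * complex.Re `|Z z| <= G / (1 - E).
  rewrite -lerC (_ : (_ * _)%:C = eta%:C * `|Z z|); last by rewrite [in RHS]normE rmorphM.
  apply: (@le_trans _ _ (G / (1 - expR (ln q * (- complex.Re z - th / t0))))%:C); last by rewrite lerC.
  by apply: le_trans h2; apply: ler_wpM2r.
have := le_trans hM (_ : complex.Re `|Z z| <= G / (1 - E) / eta).
rewrite ler_pdivlMr // mulrC => /(_ h5); rewrite /M; lra.
Qed.

End NoPole.

Theorem proposition4p6 (R : realType) (K : localFieldType)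
    (pi : valuation_ring K) (n : nat)
    (mu : {measure set (Kn K n) -> \bar R})
    (f g : mpoly n (valuation_ring K))
    (chi : valuation_ring K -> R[i])
    (t0 : R) (Z : R[i] -> R[i]) :
  uniformizer pi ->
  is_haar mu ->
  (2 <= n)%N ->
  ~ (exists h, f = mpolyC n pi * h) ->
  ~ (exists h, g = mpolyC n pi * h) ->
  ~ (exists c, f = mpolyC n c) ->
  ~ (exists c, g = mpolyC n c) ->
  mcoprime f g ->
  meval (fun _ => 0) f = 0 ->
  meval (fun _ => 0) g = 0 ->
  newton R f <> newton R g ->
  newton_nondegenerate R f g ->
  is_character chi ->
  diag_line R n `&` boundary (newton R (f * g)) = [set const_mx t0] ->
  is_zeta pi mu chi f g Z ->
  forall s : R[i], is_pole Z s -> complex.Re s < 0 ->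
    (chi <> chi_triv R K -> complex.Re s <= - (1 / t0)) /\
    (chi = chi_triv R K -> complex.Re s = - 1 \/ complex.Re s <= - (1 / t0)).
Proof.
move=> hpi hmu _ _ _ fC gC _ f0 _ _ hnd hchi hdiag hZ s hpole s0.
have fn0 : f != 0 by apply/eqP => fE; apply: fC; exists 0; rewrite fE mpolyC0.
have gn0 : g != 0 by apply/eqP => gE; apply: gC; exists 0; rewrite gE mpolyC0.
have [c hc] := conductor_exists hchi.
have hcl : closure (newton R (f * g)) (const_mx t0).
  have : [set const_mx t0 : 'rV[R]_n] (const_mx t0) by [].
  by rewrite -hdiag => -[_ []].
have t0_gt0 := diag_gt0 fn0 f0 hcl.
have ht k a : is_dmin k f a -> a%:R <= t0 * (\sum_l k l)%:R by apply: is_dmin_diag hcl.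
have q1 := qR_gt1 R K; have q0 := qR_gt0 R K; have lq0 := lnq_gt0 R K.
split=> [ntriv|triv].
  rewrite leNgt; apply/negP => st.
  have hk : cancelling chi (0 : R)%:C.
    right; split=> //; apply: contrapT => none; apply: ntriv.
    apply/funext => u; rewrite /chi_triv; case: ifP => [hu|/negbT hu]; last first.
      by case: hchi => _ _ _; exact.
    by apply/eqP/negPn/negP => cu; apply: none; exists u.
  have km : 0 * expR (- (ln (qcard K)%:R * complex.Re s)) != 1 :> R.
    by rewrite mul0r eq_sym oner_eq0.
  exact: (no_pole hpi hmu hc hnd fn0 gn0 t0_gt0 (lexx 0) ler01 ht hk hZ s0 st km hpole).
have [e|ne] := eqVneq (complex.Re s) (- 1); [by left|right].
rewrite leNgt; apply/negP => st.
have hk : cancelling chi ((qcard K)%:R^-1 : R)%:C.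
  by left; rewrite fmorphV rmorph_nat.
have km : (qcard K)%:R^-1 * expR (- (ln (qcard K)%:R * complex.Re s)) != 1 :> R.
  rewrite -[X in X^-1](lnK (x := (qcard K)%:R)) ?posrE // -expRN -expRD -[X in _ != X]expR0.
  rewrite (inj_eq (@expR_inj R)) -opprD oppr_eq0 -[X in X + _]mulr1 -mulrDr.
  by rewrite mulf_eq0 gt_eqF //= addrC addr_eq0.
have k1 : (qcard K)%:R^-1 <= 1 :> R by rewrite invf_le1 // ltW.
have k0 : 0 <= (qcard K)%:R^-1 :> R by rewrite invr_ge0 ltW.
exact: (no_pole hpi hmu hc hnd fn0 gn0 t0_gt0 k0 k1 ht hk hZ s0 st km hpole).
Qed.
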